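(* Let $\mathcal D=(V,E)$ be a directed acyclic graph on $V=\{1,\dots,p\}$ in a parent ordering, $U$ a symmetric positive definite $p\times p$ matrix, and $\alpha\in\mathbb R^p$ with $\alpha_i>pa_i+2$ for all $i$. Suppose $\Sigma^E\sim\pi^{\mathrm S_{\mathcal D}}_{U,\alpha}$, with $\Sigma\in\mathrm{PD}_{\mathcal D}$ the completion of $\Sigma^E$. Then: (i) The pairs $\big(\Sigma_{ii\mid\prec i\succ},\,\Sigma_{\prec i\succ}^{-1}\Sigma_{\prec i]}\big)$, $i\in V$, are mutually independent (i.e. $\pi^{\mathrm S_{\mathcal D}}_{U,\alpha}$ has this strong directed hyper-Markov factorization). (ii) For each $i\in V$, $$\Sigma_{ii\mid\prec i\succ}\sim IG\Big(\frac{\alpha_i}2-\frac{pa_i}2-1,\ \frac12U_{ii\mid\prec i\succ}\Big)$$ and $$\Sigma_{\prec i\succ}^{-1}\Sigma_{\prec i]}\ \Big|\ \Sigma_{ii\mid\prec i\succ}\ \sim\ \mathrm N_{pa_i}\Big(U_{\prec i\succ}^{-1}U_{\prec i]},\ \Sigma_{ii\mid\prec i\succ}U_{\prec i\succ}^{-1}\Big).$$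
   Context: Parent ordering: every directed edge $i\to j$ satisfies $i>j$. $E$ contains all loops $(i,i)$, and for $i\neq j$, $(i,j)\in E$ means $i\to j$. $\mathrm{pa}(i)$ is the set of parents of $i$ (excluding $i$), $pa_i=|\mathrm{pa}(i)|$. For a $p\times p$ matrix $A$: $A_{\prec i\succ}$ is the principal submatrix indexed by $\mathrm{pa}(i)$; $A_{\prec i]}=(A_{ji})_{j\in\mathrm{pa}(i)}$ (column), $A_{[i\succ}=(A_{ij})_{j\in\mathrm{pa}(i)}$ (row); $A_{\prec i\succ}^{-1}=(A_{\prec i\succ})^{-1}$; $A_{ii\mid\prec i\succ}=A_{ii}-A_{[i\succ}A_{\prec i\succ}^{-1}A_{\prec i]}$. For an empty parent set the associated vectors and quadratic forms are absent. $\mathcal L_{\mathcal D}$: real lower triangular $p\times p$ matrices with unit diagonal and $L_{ij}=0$ for $i\neq j$, $i\notin\mathrm{pa}(j)$. $\Theta_{\mathcal D}$: pairs $(D,L)$ with $D$ diagonal with strictly positive diagonal and $L\in\mathcal L_{\mathcal D}$. The DAG--Wishart distribution $\pi^{\Theta_{\mathcal D}}_{U,\alpha}$ is the probability law with density proportional to $\exp\{-\frac12\operatorname{tr}(LD^{-1}L^\top U)\}\prod_iD_{ii}^{-\alpha_i/2}$ with respect to $\prod_idD_{ii}\prod_i\prod_{j\in\mathrm{pa}(i)}dL_{ji}$ (proper because $\alpha_i>pa_i+2$). $\mathrm{PD}_{\mathcal D}=\{L^{-\top}DL^{-1}:(D,L)\in\Theta_{\mathcal D}\}$. $A\mapsto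 A^E$ is the projection keeping only the diagonal entries of a symmetric matrix and the entries on edges of the undirected version of $\mathcal D$. $\mathrm S_{\mathcal D}=\{\Sigma^E:\Sigma\in\mathrm{PD}_{\mathcal D}\}$; each element has a unique completion in $\mathrm{PD}_{\mathcal D}$. $\pi^{\mathrm S_{\mathcal D}}_{U,\alpha}$ is the image of $\pi^{\Theta_{\mathcal D}}_{U,\alpha}$ under $(D,L)\mapsto(L^{-\top}DL^{-1})^E$. $IG(a,b)$ has density $b^a\Gamma(a)^{-1}x^{-a-1}e^{-b/x}$, $x>0$. *)

(* Defs.v *)
From HB Require Import structures.
From mathcomp Require Export all_boot all_order all_algebra.
From mathcomp Require Export all_classical all_reals all_analysis.
From mathcomp Require Export measurable_realfun.

Set Implicit Arguments.
Unset Strict Implicit.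
Unset Printing Implicit Defensive.

Import Order.TTheory GRing.Theory Num.Theory.
Import numFieldNormedType.Exports.

Local Open Scope classical_set_scope.
Local Open Scope ring_scope.

(* Borel sets of 'M[R]_(m, n): the sigma-algebra generated by the entries. *)

Definition measure_matrix_display : measure_display.
Proof. exact. Qed.

Section measurable_matrix.
Context {R : realType} {m n : nat}.

Definition matrix_measurable : set (set 'M[R]_(m, n)) :=
  <<s [set A | exists (i : 'I_m) (j : 'I_n), exists2 B : set R,
         measurable B & A = [set M : 'M[R]_(m, n) | B (M i j)]] >>.

Let matrix_set0 : matrix_measurable set0.
Proof. exact: sigma_algebra0. Qed.

Let matrix_setC A : matrix_measurable A -> matrix_measurable (~` A).
Proof. exact: sigma_algebraC. Qed.

Let matrix_bigcup (F : (set 'M[R]_(m, n))^nat) :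
  (forall i, matrix_measurable (F i)) -> matrix_measurable (\bigcup_i (F i)).
Proof. exact: sigma_algebra_bigcup. Qed.

HB.instance Definition _ := @isMeasurable.Build measure_matrix_display
  'M[R]_(m, n) matrix_measurable matrix_set0 matrix_setC matrix_bigcup.

Lemma measurable_entry i j : measurable_fun setT (fun M : 'M[R]_(m, n) => M i j).
Proof.
move=> _ B mB; rewrite setTI; apply: sub_sigma_algebra.
by exists i, j, B.
Qed.

Lemma measurable_fun_matrix d (T : measurableType d) (f : T -> 'M[R]_(m, n)) :
  (forall i j, measurable_fun setT (fun t => f t i j)) -> measurable_fun setT f.
Proof.
move=> mf; apply: (@measurability _ _ _ _ _ _ [set A | exists i j,
  exists2 B : set R, measurable B & A = [set M : 'M[R]_(m, n) | B (M i j)]]) => //.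
move=> _ [_ [i [j [B mB ->]]] <-].
exact: mf.
Qed.

End measurable_matrix.

(* Lebesgue measure on R^n *)

Section lebesgue_cV.
Context {R : realType}.

Definition cons_cV n (x : R * 'cV[R]_n) : 'cV[R]_n.+1 := col_mx x.1%:M x.2.

Lemma measurable_cons_cV n : measurable_fun setT (@cons_cV n).
Proof.
apply: measurable_fun_matrix => i j; rewrite /cons_cV.
case: (split_ordP (i : 'I_(1 + n))) => k ->.
  rewrite (_ : (fun _ => _) = fst) //; apply/funext => x.
  by rewrite /= [LHS]col_mxEu mxE (ord1 j) (ord1 k) eqxx.
rewrite (_ : (fun _ => _) = (fun v : 'cV_n => v k j) \o snd).
  by apply: measurableT_comp => //; exact: measurable_entry.
by apply/funext => x /=; rewrite [LHS]col_mxEd.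
Qed.

Let uncons_cV n (v : 'cV[R]_n.+1) : R * 'cV[R]_n :=
  (v ord0 0, \col_i v (rshift 1 i) 0).

Let measurable_uncons_cV n : measurable_fun setT (@uncons_cV n).
Proof.
apply/measurable_fun_pairP; split; first exact: measurable_entry.
apply: measurable_fun_matrix => i j.
rewrite (_ : (fun _ => _) = (fun v : 'cV_n.+1 => v (rshift 1 i) 0)).
  exact: measurable_entry.
by apply/funext => v /=; rewrite mxE.
Qed.

Let cons_cVK n : cancel (@cons_cV n) (@uncons_cV n).
Proof.
move=> [x v]; rewrite /uncons_cV /cons_cV /=; congr pair.
  rewrite (_ : ord0 = lshift n (0 : 'I_1)); last exact: val_inj.
  by rewrite [LHS]col_mxEu mxE eqxx.
by apply/matrixP => i j; rewrite mxE [LHS]col_mxEd (ord1 j).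
Qed.

Section lebesgue_cons.
Variables (n : nat) (mu : {sigma_finite_measure set 'cV[R]_n -> \bar R}).

Definition lebesgue_cons : set 'cV[R]_n.+1 -> \bar R :=
  pushforward (lebesgue_measure \x mu)%E (@cons_cV n).

Let lebesgue_cons0 : lebesgue_cons set0 = 0%E.
Proof. by rewrite /lebesgue_cons /pushforward preimage_set0 measure0. Qed.

Let lebesgue_cons_ge0 A : (0 <= lebesgue_cons A)%E.
Proof. by rewrite /lebesgue_cons /pushforward measure_ge0. Qed.

Let lebesgue_cons_sigma_additive : semi_sigma_additive lebesgue_cons.
Proof.
have mf := @measurable_cons_cV n.
exact: measure_semi_sigma_additive.
Qed.

HB.instance Definition _ := isMeasure.Build _ _ _ lebesgue_cons
  lebesgue_cons0 lebesgue_cons_ge0 lebesgue_cons_sigma_additive.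

Let lebesgue_cons_sigma_finite : sigma_finite setT lebesgue_cons.
Proof.
have /sigma_finiteP[F [FT ndF Ffin]] := sigma_finiteT (@lebesgue_measure R).
have /sigma_finiteP[G [GT ndG Gfin]] := sigma_finiteT mu.
exists (fun k => @uncons_cV n @^-1` (F k `*` G k)).
  apply/esym; rewrite -subTset => v _.
  have [k _ Fk] : (\bigcup_k F k) (uncons_cV v).1 by rewrite -FT.
  have [l _ Gl] : (\bigcup_l G l) (uncons_cV v).2 by rewrite -GT.
  exists (maxn k l) => //; split.
    by move: Fk; exact/subsetPset/ndF/leq_maxl.
  by move: Gl; exact/subsetPset/ndG/leq_maxr.
move=> k; have [mFk Fk] := Ffin k; have [mGk Gk] := Gfin k.
have mFG : measurable (F k `*` G k) by exact: measurableX.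
split; first by rewrite -[X in measurable X]setTI; exact: measurable_uncons_cV.
rewrite /lebesgue_cons /pushforward -comp_preimage (_ : _ \o _ = id).
  by rewrite preimage_id product_measure1E // lte_mul_pinfty // ge0_fin_numE.
by apply/funext => x /=; rewrite cons_cVK.
Qed.

HB.instance Definition _ := Measure_isSigmaFinite.Build _ _ _ lebesgue_cons
  lebesgue_cons_sigma_finite.

End lebesgue_cons.

Fixpoint lebesgue_cV n : {sigma_finite_measure set 'cV[R]_n -> \bar R} :=
  if n is n'.+1 then lebesgue_cons (lebesgue_cV n') else \d_(0 : 'cV[R]_0).

Lemma lebesgue_cV_box n (B : 'I_n -> set R) : (forall i, measurable (B i)) ->
  lebesgue_cV n [set v | forall i, B i (v i 0)] =
  (\prod_(i < n) lebesgue_measure (B i))%E.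
Proof.
elim: n B => [|n IHn] B mB.
  rewrite big_ord0 /= diracE mem_set //; first by case.
have mbox : measurable [set v : 'cV[R]_n | forall i, B (lift ord0 i) (v i 0)].
  rewrite (_ : [set v | _] = \bigcap_(i in [set: 'I_n])
      ((fun v : 'cV[R]_n => v i 0) @^-1` B (lift ord0 i))).
    apply: fin_bigcap_measurable => // i _; rewrite -[X in measurable X]setTI.
    exact: measurable_entry.
  by apply/seteqP; split=> [v Bv i _|v Bv i]; [exact: Bv|exact: (Bv i)].
have E0 (x : R * 'cV[R]_n) : cons_cV x ord0 0 = x.1.
  by rewrite -[in RHS](cons_cVK x).
have ES (x : R * 'cV[R]_n) i : cons_cV x (lift ord0 i) 0 = x.2 i 0.
  rewrite -[in RHS](cons_cVK x) /= mxE; congr (cons_cV x _ 0).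
  exact: val_inj.
rewrite big_ord_recl -IHn // /= /lebesgue_cons /pushforward.
rewrite -product_measure1E //; last exact: (mB ord0).
congr (product_measure1 _ _ _); apply/seteqP; split=> x /=.
  by move=> Bx; split=> [|i]; [rewrite -E0|rewrite -ES]; exact: Bx.
by case=> B0 BS i; case: (unliftP ord0 i) => [j|] ->; rewrite ?ES ?E0.
Qed.

End lebesgue_cV.

Definition posdef {R : realType} n (A : 'M[R]_n) :=
  A^T = A /\ forall x : 'cV[R]_n, x != 0 -> 0 < (x^T *m A *m x) 0 0.

(* A DAG on 'I_p in a parent ordering is given by its edge relation E, loops  *)
(* included; acyclicity follows from the ordering of the edges.               *)

Section dag.
Context {p : nat}.
Implicit Types (E : rel 'I_p) (i j : 'I_p).

Definition parent_ordered_dag E :=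
  (forall i, E i i) /\ (forall i j, i != j -> E i j -> (j < i)%N).

Definition pa E i : {set 'I_p} := [set j | (j != i) && E j i].

Definition pa_val E i (k : 'I_#|pa E i|) : 'I_p := enum_val k.

(* the proper edges (i, j), i -> j *)
Definition edges E : {set 'I_p * 'I_p} := [set e | e.1 \in pa E e.2].

Section matrices.
Context {R : realType}.
Implicit Types A D L : 'M[R]_p.

Definition pa_mx E A i : 'M[R]_#|pa E i| := mxsub (@pa_val E i) (@pa_val E i) A.
Definition pa_col E A i : 'cV[R]_#|pa E i| := \col_k A (pa_val k) i.
Definition pa_row E A i : 'rV[R]_#|pa E i| := \row_k A i (pa_val k).

Definition cond_var E A i : R :=
  A i i - (pa_row E A i *m invmx (pa_mx E A i) *m pa_col E A i) 0 0.

Definition reg_coef E A i : 'cV[R]_#|pa E i| :=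
  invmx (pa_mx E A i) *m pa_col E A i.

Definition dag_lower E : set 'M[R]_p := [set L |
  [/\ is_trig_mx L, forall i, L i i = 1
    & forall i j, i != j -> i \notin pa E j -> L i j = 0]].

Definition dag_Theta E : set ('M[R]_p * 'M[R]_p) := [set DL |
  [/\ is_diag_mx DL.1, forall i, 0 < DL.1 i i & dag_lower E DL.2]].

Definition dag_cov (DL : 'M[R]_p * 'M[R]_p) : 'M[R]_p :=
  invmx DL.2^T *m DL.1 *m invmx DL.2.

Definition dag_PD E : set 'M[R]_p := dag_cov @` dag_Theta E.

(* A^E, with the entries that are not kept set to 0 *)
Definition dag_proj E A : 'M[R]_p :=
  \matrix_(i, j) if E i j || E j i then A i j else 0.

Definition dag_completion E (AE A : 'M[R]_p) :=
  dag_PD E A /\ dag_proj E A = AE.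

(* Free parameters of Theta_D: the diagonal of D, and the entries of L on the *)
(* proper edges.                                                              *)
Definition param_Theta E (x : 'cV[R]_p * 'cV[R]_#|edges E|) :
    'M[R]_p * 'M[R]_p :=
  (diag_mx x.1^T,
   1%:M + \sum_(k < #|edges E|)
     x.2 k 0 *: delta_mx (enum_val k).1 (enum_val k).2).

Lemma measurable_param_Theta E : measurable_fun setT (@param_Theta E).
Proof.
apply/measurable_fun_pairP; split; apply: measurable_fun_matrix => i j.
  under eq_fun do rewrite /= !mxE.
  have [_|_] := eqVneq i j; last exact: measurable_cst.
  apply: (@measurableT_comp _ _ _ _ _ _ (fun v : 'cV[R]_p => v i 0)) => //.
  exact: measurable_entry.
under eq_fun do rewrite /= mxE summxE.
apply: measurable_funD => //; apply: measurable_sum => k.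
under eq_fun do rewrite mxE; apply: measurable_funM => //.
apply: (@measurableT_comp _ _ _ _ _ _ (fun v : 'cV[R]_#|edges E| => v k 0)) => //.
exact: measurable_entry.
Qed.

(* prod_i dD_ii prod_i prod_(j in pa(i)) dL_ji *)
Definition lebesgue_Theta E : set ('M[R]_p * 'M[R]_p) -> \bar R :=
  pushforward (lebesgue_cV p \x lebesgue_cV #|edges E|)%E (@param_Theta E).

Definition dag_wishart_density (U : 'M[R]_p) (alpha : 'I_p -> R)
    (DL : 'M[R]_p * 'M[R]_p) : R :=
  expR (- (1 / 2) * \tr (DL.2 *m invmx DL.1 *m DL.2^T *m U)) *
  \prod_i (DL.1 i i) `^ (- (alpha i / 2)).

Definition dag_wishart_mass E U alpha (A : set ('M[R]_p * 'M[R]_p)) : \bar R :=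
  (\int[lebesgue_Theta E]_(DL in A `&` dag_Theta E)
     (dag_wishart_density U alpha DL)%:E)%E.

Definition dag_wishart_Theta E U alpha (A : set ('M[R]_p * 'M[R]_p)) : \bar R :=
  (dag_wishart_mass E U alpha A *
   (fine (dag_wishart_mass E U alpha setT))^-1%:E)%E.

Definition dag_wishart_S E U alpha : set 'M[R]_p -> \bar R :=
  pushforward (dag_wishart_Theta E U alpha) (dag_proj E \o dag_cov).

End matrices.
End dag.

Section distributions.
Context {R : realType}.

Definition Gamma (a : R) : R :=
  Rintegral lebesgue_measure `]0, +oo[
    (fun x => x `^ (a - 1) * expR (- x)).

Definition inverse_gamma_pdf (a b x : R) : R :=
  b `^ a / Gamma a * x `^ (- a - 1) * expR (- b / x).

Definition inverse_gamma (a b : R) (A : set R) : \bar R :=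
  (\int[lebesgue_measure]_(x in A `&` `]0%R, +oo[)
     (inverse_gamma_pdf a b x)%:E)%E.

Definition mvnormal_pdf n (m : 'cV[R]_n) (S : 'M[R]_n) (x : 'cV[R]_n) : R :=
  expR (- (1 / 2) * ((x - m)^T *m invmx S *m (x - m)) 0 0) /
  Num.sqrt ((2 * pi) ^+ n * \det S).

(* N_n(m, S) for S positive definite; for n = 0 it is the Dirac mass *)
Definition mvnormal n (m : 'cV[R]_n) (S : 'M[R]_n) (A : set 'cV[R]_n) : \bar R :=
  (\int[lebesgue_cV n]_(x in A) (mvnormal_pdf m S x)%:E)%E.

End distributions.

Section laws.
Context d (T : measurableType d) (R : realType) (P : probability T R).

Definition has_law d' (S : measurableType d') (X : T -> S)
    (mu : set S -> \bar R) :=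
  measurable_fun setT X /\
  forall A, measurable A -> P (X @^-1` A) = mu A.

(* conditionally on Y, X has law kappa Y *)
Definition has_cond_law d1 d2 (S1 : measurableType d1) (S2 : measurableType d2)
    (X : T -> S2) (Y : T -> S1) (kappa : S1 -> set S2 -> \bar R) :=
  [/\ measurable_fun setT X, measurable_fun setT Y,
    forall B, measurable B -> measurable_fun setT (kappa ^~ B)
  & forall A B, measurable A -> measurable B ->
      P (Y @^-1` A `&` X @^-1` B) = (\int[P]_(t in Y @^-1` A) kappa (Y t) B)%E].

Definition mutually_independent (I : finType) d' (S : I -> measurableType d')
    (X : forall i, T -> S i) :=
  (forall i, measurable_fun setT (X i)) /\
  forall (J : {set I}) (B : forall i, set (S i)),
    (forall i, measurable (B i)) ->
    P (\bigcap_(i in [set i | i \in J]) (X i @^-1` B i)) =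
      (\prod_(i in J) P (X i @^-1` B i))%E.

End laws.

(* Main.v *)
From HB Require Import structures.
Require Import Defs.
From mathcomp Require Import ring lra.
Import Order.TTheory GRing.Theory Num.Theory.
Import numFieldNormedType.Exports.
Local Open Scope classical_set_scope.
Local Open Scope ring_scope.

Set Implicit Arguments.
Unset Strict Implicit.
Unset Printing Implicit Defensive.

(** Let [Sigma = L^-T D L^-1].  As [L^-T] is upper unitriangular, the entries
    of [Sigma L = L^-T D] on and below the diagonal are those of [D].  Column
    [i] of this identity says that [L_{pa(i), i}] is minus the regression
    coefficient of [i] on its parents and that [D_ii] is the conditional
    variance ([reg_coef_dag_cov], [cond_var_dag_cov]).  So the pairs of the
    theorem are, up to a sign, the parameters [D_ii, L_{pa(i), i}], and each
    free parameter occurs in exactly one of them.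

    The density splits along the same blocks: the trace in it is the sum over
    [i] of [D_ii^-1 (L^T U L)_ii], and completing the square in column [i] of
    [L] turns [(L^T U L)_ii] into [U_{ii|pa(i)}] plus the quadratic form of
    [U_{pa(i)}] at the deviation of the regression coefficient from that of
    [U] ([lower_congr_diag]).  By Tonelli's theorem, applied after sorting the
    coordinates by blocks ([integral_lebesgue_cV_blocks]), the mass of a
    product of sets is a product over [i] of integrals
    ([dag_wishart_mass_blocks]).  Normalizing gives independence, and the law
    of each block is its normalized factor ([product_law_independent],
    [product_law_marginal]).  That all the factors are finite and nonzero
    follows from the law of [SigmaE] being a probability
    ([product_law_mass]).

    Within a block, for fixed [d = D_ii], the density is a Gaussian one in the
    regression coefficient, with mean [U_{pa(i)}^-1 U_{pa(i), i}] and
    covariance [d U_{pa(i)}^-1].  Its integral ([integral_gauss], by induction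
    on the dimension with a Schur complement) contributes the power
    [d^(pa_i / 2)], which leaves the inverse gamma density in [d].  The
    normalizing constant of the latter is brought to the Gamma integral by the
    substitution [y = b / x] ([integral_inverse_gamma]).

    The conditional variances and regression coefficients involve entries of
    [Sigma] that [Sigma^E] does not keep.  They are nevertheless measurable
    functions of [Sigma^E], because the completion is computed by finitely many
    measurable steps ([completionE], [measurable_completion]). *)

(** * Measurable matrix operations *)

(** Inversion is not continuous at 0.  Splitting by sign reduces it to the power
    function with exponent -1, which vanishes at 0. *)
Lemma measurable_inv {R : realType} : measurable_fun setT (@GRing.inv R).
Proof.
have mpow := @measurable_powR R (-1).
rewrite (_ : GRing.inv = fun x : R =>
    Num.max x 0 `^ (-1) - Num.max (- x) 0 `^ (-1)); last first.
  apply/funext => x; have [x0|x0] := leP 0 x.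
    rewrite (max_r (x := - x)) ?oppr_le0//.
    by rewrite powR0 ?oppr_eq0 ?oner_eq0// subr0 powR_inv1.
  rewrite (max_l (x := - x)) ?oppr_ge0 ?ltW//.
  rewrite powR0 ?oppr_eq0 ?oner_eq0// sub0r powR_inv1 ?oppr_ge0 ?ltW//.
  by rewrite invrN opprK.
by apply: measurable_funB; apply: (measurableT_comp mpow);
  apply: measurable_maxr.
Qed.

Section measurable_matrix_operations.
Context {R : realType} d (T : measurableType d).

Lemma measurable_fun_entry m n (f : T -> 'M[R]_(m, n)) i j :
  measurable_fun setT f -> measurable_fun setT (fun t => f t i j).
Proof.
by move=> mf; apply: (measurableT_comp (@measurable_entry R m n i j)).
Qed.

Lemma measurable_mulmx m n q (f : T -> 'M[R]_(m, n)) (g : T -> 'M[R]_(n, q)) :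
  measurable_fun setT f -> measurable_fun setT g ->
  measurable_fun setT (fun t => f t *m g t).
Proof.
move=> mf mg; apply: measurable_fun_matrix => i j.
under eq_fun do rewrite mxE.
apply: measurable_sum => k.
by apply: measurable_funM; exact: measurable_fun_entry.
Qed.

Lemma measurable_det n (f : T -> 'M[R]_n) :
  measurable_fun setT f -> measurable_fun setT (fun t => \det (f t)).
Proof.
move=> mf; apply: measurable_sum => s; apply: measurable_funM => //.
by apply: measurable_prod => i _; exact: measurable_fun_entry.
Qed.

(** Where the determinant vanishes [invmx] returns its argument; elsewhere it is a
    rational function of the entries. *)
Lemma measurable_invmx n (f : T -> 'M[R]_n) :
  measurable_fun setT f -> measurable_fun setT (fun t => invmx (f t)).
Proof.
move=> mf; apply: measurable_fun_matrix => i j.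
have mdet := measurable_det mf.
rewrite (_ : (fun t => _) = (fun t => if \det (f t) == 0 then f t i j
    else (\det (f t))^-1 * cofactor (f t) j i)); last first.
  apply/funext => t; rewrite /invmx unitmxE unitfE.
  by case: eqP => //= _; rewrite !mxE.
apply: measurable_fun_ifT; first exact: measurable_fun_eqr.
  exact: measurable_fun_entry.
apply: measurable_funM.
  exact: measurableT_comp measurable_inv mdet.
apply: measurable_funM => //.
apply: measurable_det; apply: measurable_fun_matrix => a b.
by under eq_fun do rewrite !mxE; exact: measurable_fun_entry.
Qed.

Lemma measurable_trmx m n (f : T -> 'M[R]_(m, n)) :
  measurable_fun setT f -> measurable_fun setT (fun t => (f t)^T).
Proof.
move=> mf; apply: measurable_fun_matrix => i j.
by under eq_fun do rewrite mxE; exact: measurable_fun_entry.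
Qed.

Lemma measurable_mxsub m n m' n' (f : T -> 'M[R]_(m, n))
    (g : 'I_m' -> 'I_m) (h : 'I_n' -> 'I_n) :
  measurable_fun setT f -> measurable_fun setT (fun t => mxsub g h (f t)).
Proof.
move=> mf; apply: measurable_fun_matrix => i j.
by under eq_fun do rewrite mxE; exact: measurable_fun_entry.
Qed.

End measurable_matrix_operations.

(** * Positive definite matrices *)

Section posdef_matrices.
Context {R : realType}.

Lemma posdef_unitmx n (A : 'M[R]_n) : posdef A -> A \in unitmx.
Proof.
move=> [_ A_gt0]; rewrite -row_free_unit; apply/inj_row_free => v vA0.
apply: contrapT => /eqP v0.
have /A_gt0 : v^T != 0 by rewrite trmx_eq0.
by rewrite trmxK vA0 mul0mx mxE ltxx.
Qed.

(** Taking for [B] a selection of coordinates gives the principal submatrices of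
    [A]; taking [B = L^-1] gives the matrices [L^-T D L^-1]. *)
Lemma posdef_congr m n (A : 'M[R]_m) (B : 'M[R]_(m, n)) :
  posdef A -> (forall x : 'cV_n, B *m x = 0 -> x = 0) ->
  posdef (B^T *m A *m B).
Proof.
move=> [AT A_gt0] Binj; split; first by rewrite !trmx_mul trmxK AT mulmxA.
move=> x x0; have /A_gt0 : B *m x != 0 by apply: contra_neq x0; exact: Binj.
by rewrite trmx_mul !mulmxA.
Qed.

Lemma posdef_mxsub m n (g : 'I_n -> 'I_m) (A : 'M[R]_m) : injective g ->
  posdef A -> posdef (mxsub g g A).
Proof.
move=> ginj pA; pose B : 'M[R]_(n, m) := rowsub g 1%:M.
have -> : mxsub g g A = B^T^T *m A *m B^T.
  rewrite trmxK /B mul_rowsub_mx mul1mx; apply/matrixP => i j.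
  rewrite !mxE (bigD1 (g j)) //= !mxE eqxx mulr1 big1 ?addr0// => k kj.
  by rewrite !mxE eq_sym (negbTE kj) mulr0.
apply: posdef_congr => // x Bx0.
have BB : B *m B^T = 1%:M.
  rewrite mul_rowsub_mx mul1mx; apply/matrixP => i j.
  by rewrite !mxE (inj_eq ginj) eq_sym.
by rewrite -[x]mul1mx -BB -mulmxA Bx0 mulmx0.
Qed.

Lemma posdef_diag n (A : 'M[R]_n) : is_diag_mx A -> (forall i, 0 < A i i) ->
  posdef A.
Proof.
move=> /is_diag_mxP dA A_gt0; split.
  apply/matrixP => i j; rewrite mxE; have [->//|ij] := eqVneq i j.
  by rewrite !dA// eq_sym.
move=> x x0; have [k xk0] : exists k, x k 0 != 0.
  apply: contrapT => /forallNP xk0; move/eqP: x0; apply; apply/colP => i.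
  by rewrite mxE; apply/eqP/negPn/negP; exact: xk0.
have E i : (x^T *m A) 0 i * x i 0 = A i i * x i 0 ^+ 2.
  rewrite mxE (bigD1 i)//= big1 ?addr0 ?mxE.
    by rewrite mulrAC -expr2 mulrC.
  by move=> j ji; rewrite dA// mulr0.
rewrite mxE (bigD1 k)//= ltr_wpDr//.
  by apply: sumr_ge0 => i _; rewrite E mulr_ge0 ?sqr_ge0// ltW.
by rewrite E mulr_gt0// exprn_even_gt0.
Qed.

End posdef_matrices.

(** * Regressions and completion in [PD_D] *)

Section dag_algebra.
Context {p : nat} (E : rel 'I_p) {R : realType}.
Hypothesis hE : parent_ordered_dag E.
Implicit Types (i j : 'I_p) (D L M S : 'M[R]_p).

Lemma pa_val_inj i : injective (@pa_val p E i).
Proof. exact: enum_val_inj. Qed.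

Lemma pa_val_in i (k : 'I_#|pa E i|) : pa_val k \in pa E i.
Proof. exact: enum_valP. Qed.

Lemma pa_gt i j : j \in pa E i -> (i < j)%N.
Proof. by rewrite inE => /andP[ji Eji]; exact: (hE.2 _ _ ji Eji). Qed.

Lemma pa_val_gt i (k : 'I_#|pa E i|) : (i < pa_val k)%N.
Proof. exact/pa_gt/pa_val_in. Qed.

Lemma posdef_pa_mx M i : posdef M -> posdef (pa_mx E M i).
Proof. by move=> ?; apply: posdef_mxsub => //; exact: pa_val_inj. Qed.

Lemma dag_lower_unitmx L : dag_lower E L -> L \in unitmx.
Proof.
move=> [Ltrig L1 _]; rewrite unitmxE det_trig// big1 ?unitr1// => i _.
Qed.

Lemma posdef_dag_cov DL : dag_Theta E DL -> posdef (@dag_cov p R DL).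
Proof.
move=> [dD D_gt0 lL]; rewrite /dag_cov -trmx_inv; apply: posdef_congr.
  exact: posdef_diag.
move=> x; move/(congr1 (mulmx DL.2)); rewrite mulmxA mulmxV ?mul1mx ?mulmx0//.
exact: dag_lower_unitmx.
Qed.

(** With [S = L^-T D L^-1], [S L = L^-T D] where [L^-T] is upper unitriangular:
    this is what makes the columns of [L] solve the normal equations of the
    regressions on the parents. *)
Lemma dag_cov_mul_lower D L (i b : 'I_p) : dag_Theta E (D, L) -> (i <= b)%N ->
  (dag_cov (D, L) *m L) b i = D b i.
Proof.
move=> [/= /is_diag_mxP dD D_gt0 lL]; have Lu := dag_lower_unitmx lL.
rewrite /dag_cov /= mulmxKV//; set M := invmx L^T *m D.
have LM : L^T *m M = D by rewrite mulKVmx ?unitmx_tr.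
move: M LM => M LM.
(* downward induction on the row: [L^T M = D] with [L^T] upper unitriangular *)
have [n] := ubnP (p - b)%N; elim: n => // n IHn in b *; rewrite ltnS => bn ib.
case: lL => /is_trig_mxP Ltrig L1 _.
rewrite -[in RHS]LM mxE (bigD1 b)//= mxE L1 mul1r big1 ?addr0// => k kb.
rewrite mxE; have [bk|kb'] := ltnP b k; last first.
  by rewrite Ltrig ?mul0r// ltn_neqAle kb'/= andbT.
rewrite IHn.
- by rewrite dD ?mulr0// gtn_eqF// (leq_ltn_trans ib).
- by apply: leq_trans bn; rewrite ltn_sub2l.
- exact: (leq_trans ib (ltnW bk)).
Qed.

(** Column [i] of [L] is [e_i] plus its entries at the parents of [i]. *)
Lemma mul_lower_col S L (i b : 'I_p) : dag_lower E L ->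
  (S *m L) b i = S b i + (\row_k S b (@pa_val p E i k) *m pa_col E L i) 0 0.
Proof.
move=> [_ L1 L0]; rewrite !mxE (bigD1 i)//= L1 mulr1; congr +%R.
rewrite (eq_bigr (fun k : 'I_#|pa E i| =>
    S b (pa_val k) * L (pa_val k) i)); last by move=> k _; rewrite !mxE.
rewrite -(big_enum_val (fun k => S b k * L k i)) /=.
rewrite [LHS]big_mkcond [RHS]big_mkcond; apply: eq_bigr => k _.
case: ifPn => [ki|]; last by rewrite negbK => /eqP ->; rewrite inE eqxx.
by case: ifPn => // kpa; rewrite L0 ?mulr0// .
Qed.

(** Parents of [i] have larger indices, so in their rows column [i] of [S L]
    vanishes: [S_{pa(i), i} + S_{pa(i)} L_{pa(i), i} = 0]. *)
Lemma reg_coef_dag_cov D L i : dag_Theta E (D, L) ->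
  reg_coef E (dag_cov (D, L)) i = - pa_col E L i.
Proof.
move=> DL; set S := dag_cov _; have lL : dag_lower E L by case: DL.
have pu : pa_mx E S i \in unitmx.
  exact/posdef_unitmx/posdef_pa_mx/posdef_dag_cov.
suff eq0 : pa_col E S i + pa_mx E S i *m pa_col E L i = 0.
  rewrite /reg_coef -[RHS](mulKmx pu) mulmxN; congr (_ *m _).
  by apply/eqP; rewrite -addr_eq0 eq0.
apply/colP => k; have ik := pa_val_gt k.
have := dag_cov_mul_lower DL (ltnW ik).
rewrite (mul_lower_col _ _ _ lL).
have /is_diag_mxP -> : is_diag_mx D by case: DL.
  rewrite -/S; move: S {pu} => S Sk0; rewrite [RHS]mxE -Sk0 mxE.
  congr (_ + _); first by rewrite mxE.
  by rewrite !mxE; apply: eq_bigr => l _; rewrite !mxE.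
by rewrite gtn_eqF.
Qed.

(** The same equation in a row [b] that need not be a parent of [i]: the parents
    carry all the covariance of [i] with later indices.  This determines the
    entries of [Sigma] that the projection forgets. *)
Lemma dag_cov_below D L (i b : 'I_p) : dag_Theta E (D, L) -> (i < b)%N ->
  dag_cov (D, L) b i = (\row_k dag_cov (D, L) b (@pa_val p E i k) *m
                        reg_coef E (dag_cov (D, L)) i) 0 0.
Proof.
move=> DL ib; rewrite reg_coef_dag_cov// mulmxN [in RHS]mxE.
have lL : dag_lower E L by case: DL.
have := dag_cov_mul_lower DL (ltnW ib); rewrite (mul_lower_col _ _ _ lL).
have /is_diag_mxP -> : is_diag_mx D by case: DL.
  by move/eqP; rewrite addr_eq0 => /eqP.
by rewrite gtn_eqF.
Qed.

Lemma cond_var_dag_cov D L i : dag_Theta E (D, L) ->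
  cond_var E (dag_cov (D, L)) i = D i i.
Proof.
move=> DL; rewrite /cond_var -mulmxA -/(reg_coef E _ i) reg_coef_dag_cov//.
have lL : dag_lower E L by case: DL.
rewrite mulmxN [X in _ - X]mxE opprK -(dag_cov_mul_lower DL (leqnn i)).
by rewrite (mul_lower_col _ _ _ lL).
Qed.

End dag_algebra.

Section completion.
Context {p : nat} (E : rel 'I_p) {R : realType}.
Implicit Types (i c : 'I_p) (D L M S : 'M[R]_p).

Definition completion_entry M i c : R :=
  (\row_k M c (@pa_val p E i k) *m reg_coef E M i) 0 0.

Definition completion_step M : 'M[R]_p :=
  \matrix_(a, b) if E a b || E b a then M a b
    else if (a < b)%N then completion_entry M a b else completion_entry M b a.

(** The completion of [Sigma^E] is built column by column, from the last index
    down: column [i] is determined by the principal submatrix on the indices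
    above [i].  Each step redoes all the columns at once, so that after [n]
    steps those of the last [n] indices are final. *)
Definition completion M : 'M[R]_p := iter p completion_step M.

Definition agree_from S k M := forall a b : 'I_p,
  E a b || E b a || ((k <= a) && (k <= b))%N -> M a b = S a b.

Hypothesis hE : parent_ordered_dag E.

(** The regression of [i] on its parents involves the indices above [i] and the
    edges into [i] only, and both are already right. *)
Lemma agree_completion_step D L k M : dag_Theta E (D, L) ->
  agree_from (dag_cov (D, L)) k.+1 M ->
  agree_from (dag_cov (D, L)) k (completion_step M).
Proof.
move=> DL; have ST a b : dag_cov (D, L) a b = dag_cov (D, L) b a.
  by have [/matrixP/(_ b a) + _] := posdef_dag_cov DL; rewrite mxE.
have := fun i c => dag_cov_below hE DL (i := i) (b := c).
move: (dag_cov _) ST => S ST Sbelow SM.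
have entryE i c : (k <= i)%N -> (i < c)%N -> completion_entry M i c = S c i.
  move=> ki ic; rewrite [RHS]Sbelow//.
  have MS (a b : 'I_p) : (i < a)%N -> (i < b)%N -> M a b = S a b.
    by move=> ia ib; apply: SM; rewrite !(leq_ltn_trans ki)// orbT.
  rewrite /completion_entry /reg_coef; congr ((_ *m (invmx _ *m _)) _ _).
  - by apply/rowP => l; rewrite !mxE MS// pa_val_gt.
  - by apply/matrixP => l m; rewrite !mxE MS// pa_val_gt.
  - apply/colP => l; rewrite !mxE SM//.
    by have := pa_val_in l; rewrite inE => /andP[_ ->].
move=> a b; rewrite mxE; case: ifPn => [Eab _|/= nEab /andP[ka kb]].
  by rewrite SM// Eab.
case: ltnP => [ab|]; first by rewrite entryE.
rewrite leq_eqVlt => /predU1P[ba|ba]; last by rewrite entryE.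
by move: nEab; rewrite (val_inj ba) (hE.1 a).
Qed.

Lemma completionE S : dag_PD E S -> completion (dag_proj E S) = S.
Proof.
move=> [[D L] DL <-]; set S0 := dag_cov _.
suff H n : agree_from S0 (p - n) (iter n completion_step (dag_proj E S0)).
  by apply/matrixP => a b; apply: H; rewrite subnn !leq0n orbT.
elim: n => [|n IHn] /=.
  move=> a b; rewrite subn0 !mxE leqNgt ltn_ord andFb orbF.
  by move=> ->.
have [pn|np] := leqP p n.
  move: IHn; have -> : (p - n.+1 = 0)%N by apply/eqP; rewrite subn_eq0 leqW.
  move=> IHn; apply: agree_completion_step => // a b _.
  by apply: IHn; move/eqP: pn => ->; rewrite !leq0n orbT.
by apply: agree_completion_step => //; rewrite -subSn.
Qed.

Lemma measurable_reg_coef i : measurable_fun setT (fun M => reg_coef E M i).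
Proof.
apply: measurable_mulmx.
  by apply: measurable_invmx; apply: measurable_mxsub.
by apply: measurable_fun_matrix => a b; under eq_fun do rewrite mxE;
  exact: measurable_entry.
Qed.

Lemma measurable_cond_var i : measurable_fun setT (fun M => cond_var E M i).
Proof.
apply: measurable_funB; first exact: measurable_entry.
under eq_fun do rewrite -mulmxA.
apply: measurable_fun_entry; apply: measurable_mulmx.
  by apply: measurable_fun_matrix => a b; under eq_fun do rewrite mxE;
    exact: measurable_entry.
exact: measurable_reg_coef.
Qed.

Lemma measurable_completion : measurable_fun setT completion.
Proof.
suff H n : measurable_fun setT (iter n completion_step) by exact: H.
elim: n => [|n IHn]; first exact: measurable_id.
rewrite (_ : iter n.+1 _ = completion_step \o iter n completion_step)//.
apply: measurableT_comp => //; apply: measurable_fun_matrix => a b.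
under eq_fun do rewrite mxE.
have mentry i c : measurable_fun setT (fun M => completion_entry M i c).
  apply: measurable_fun_entry; apply: measurable_mulmx.
    by apply: measurable_fun_matrix => k l; under eq_fun do rewrite mxE;
      exact: measurable_entry.
  exact: measurable_reg_coef.
case: (E a b || E b a); first exact: measurable_entry.
by case: (a < b)%N; exact: mentry.
Qed.

Lemma measurable_dag_cov :
  measurable_fun setT (@dag_cov p R).
Proof.
apply: measurable_mulmx; first apply: measurable_mulmx => //.
- by apply: measurable_invmx; apply: measurable_trmx.
- exact: measurable_invmx.
Qed.

Lemma measurable_dag_proj : measurable_fun setT (@dag_proj p R E).
Proof.
apply: measurable_fun_matrix => a b; under eq_fun do rewrite mxE.
by case: (E a b || E b a); [exact: measurable_entry|exact: measurable_cst].
Qed.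

End completion.

(** * Lebesgue measure on column vectors *)

Section ereal_products.
Context {R : realType}.
Local Open Scope ereal_scope.

Lemma prode_ge0 (I : Type) (s : seq I) (Q : pred I) (f : I -> \bar R) :
  (forall i, 0 <= f i) -> 0 <= \prod_(i <- s | Q i) f i.
Proof. by move=> f0; elim/big_ind: _ => //= x y; exact: mule_ge0. Qed.

Lemma emeasurable_prod d (T : measurableType d) (I : Type) (s : seq I)
    (f : I -> T -> \bar R) : (forall i, measurable_fun setT (f i)) ->
  measurable_fun setT (fun t => \prod_(i <- s) f i t).
Proof.
move=> mf; elim: s => [|i s IHs].
  by under eq_fun do rewrite big_nil; exact: measurable_cst.
by under eq_fun do rewrite big_cons; exact: emeasurable_funM.
Qed.

Lemma integral_prod_mule d1 d2 (T1 : measurableType d1) (T2 : measurableType d2)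
    (m1 : {sigma_finite_measure set T1 -> \bar R})
    (m2 : {sigma_finite_measure set T2 -> \bar R})
    (f : T1 -> \bar R) (g : T2 -> \bar R) :
  measurable_fun setT f -> measurable_fun setT g ->
  (forall x, 0 <= f x) -> (forall y, 0 <= g y) ->
  \int[m1 \x m2]_z (f z.1 * g z.2) = \int[m1]_x f x * \int[m2]_y g y.
Proof.
move=> mf mg f0 g0.
rewrite fubini_tonelli1 => [|//=|z]; last exact: mule_ge0.
  rewrite /fubini_F -ge0_integralZr//; last exact: integral_ge0.
  by apply: eq_integral => x _; rewrite /= ge0_integralZl.
by apply: emeasurable_funM; [exact: (measurableT_comp mf)|
  exact: (measurableT_comp mg)].
Qed.

End ereal_products.

Lemma inj_surj_bij (A B : Type) (f : A -> B) :
  injective f -> (forall b, exists a, f a = b) -> bijective f.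
Proof.
move=> finj /choice[g fg]; exists g => // a; exact/finj/fg.
Qed.

Lemma measurable_forall_fin d (T : measurableType d) (I : finType)
    (S : I -> set T) : (forall i, measurable (S i)) ->
  measurable [set x | forall i, S i x].
Proof.
move=> mS; rewrite (_ : [set x | _] = \bigcap_(i in [set: I]) S i).
  exact: fin_bigcap_measurable.
by apply/seteqP; split=> [v Bv i _|v Bv i]; [exact: Bv|exact: (Bv i)].
Qed.

Section lebesgue_cV_uniqueness.
Context {R : realType}.

Definition box n (B : 'I_n -> set R) : set 'cV[R]_n :=
  [set v | forall i, B i (v i 0)].

Lemma measurable_box n (B : 'I_n -> set R) :
  (forall i, measurable (B i)) -> measurable (box B).
Proof.
move=> mB; apply: (measurable_forall_fin (S := fun i =>
    (fun v : 'cV[R]_n => v i 0) @^-1` B i)) => i.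
by rewrite -[X in measurable X]setTI; exact: measurable_entry.
Qed.

Lemma lebesgue_box n (B : 'I_n -> set R) : (forall i, measurable (B i)) ->
  lebesgue_cV n (box B) = (\prod_(i < n) lebesgue_measure (B i))%E.
Proof. exact: lebesgue_cV_box. Qed.

Let boxes n : set (set 'cV[R]_n) :=
  [set box B | B in [set B | forall i, measurable (B i)]].

Let measurable_boxes n : @measurable _ 'cV[R]_n = <<s @boxes n >>.
Proof.
apply/seteqP; split; last first.
  apply: smallest_sub; first exact: sigma_algebra_measurable.
  by move=> _ [B mB <-]; exact: measurable_box.
apply: smallest_sub; first exact: smallest_sigma_algebra.
move=> _ [i [j [B mB ->]]]; apply: sub_sigma_algebra.
exists (fun k => if k == i then B else setT) => [k /=|]; first by case: ifP.
apply/seteqP; split=> v /=; last first.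
  by move=> Bv k; case: eqP => // ->; rewrite -(ord1 j).
by move=> /(_ i); rewrite eqxx (ord1 j).
Qed.

(** Measurable boxes form a pi-system that generates the Borel sets, and the
    cubes [[-k, k]^n] exhaust the space. *)
Lemma lebesgue_cV_unique n (mu : {measure set 'cV[R]_n -> \bar R}) :
  (forall B, (forall i, measurable (B i)) ->
    mu (box B) = (\prod_(i < n) lebesgue_measure (B i))%E) ->
  forall A, measurable A -> lebesgue_cV n A = mu A.
Proof.
move=> muE; pose F (k : nat) : set R := [set` `[(- k%:R : R), k%:R]].
apply: (measure_unique (@boxes n) (fun k => box (fun=> F k))).
- exact: measurable_boxes.
- move=> _ _ [B mB <-] [C mC <-].
  exists (fun i => B i `&` C i) => [i|]; first exact: measurableI.
  apply/seteqP; split=> v /=; last by move=> [Bv Cv] i; split.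
  by move=> BCv; split=> i; have [] := BCv i.
- by move=> k; exists (fun=> F k) => // i; exact: measurable_itv.
- rewrite -subTset => v _.
  exists (\max_(i < n) Num.bound `|v i ord0|)%N => // i.
  rewrite /F /= in_itv /= -ler_norml ltW//.
  apply: lt_le_trans (archi_boundP (normr_ge0 (v i 0))) _.
  by rewrite ler_nat; exact: (leq_bigmax i).
- move=> _ [B mB <-]; rewrite muE//; exact: lebesgue_box.
- move=> k; suff : (lebesgue_cV n (box (fun=> F k)) < +oo)%E by [].
  rewrite lebesgue_box => [|i]; last exact: measurable_itv.
  rewrite -ge0_fin_numE ?prode_ge0// prode_fin_num// => i _.
  by rewrite /F lebesgue_measure_itv /=; case: ifP.
Qed.

Lemma lebesgue_cVN n (f : 'cV[R]_n -> \bar R) : measurable_fun setT f ->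
  (forall v, (0 <= f v)%E) ->
  (\int[lebesgue_cV n]_v f (- v)%R = \int[lebesgue_cV n]_v f v)%E.
Proof.
move=> mf f0; have mN : measurable_fun setT (-%R : 'cV[R]_n -> 'cV[R]_n).
  apply: measurable_fun_matrix => i j; under eq_fun do rewrite mxE.
  exact: measurableT_comp (measurable_entry _ _).
transitivity (\int[pushforward (lebesgue_cV n) (-%R : _ -> 'cV[R]_n)]_v f v)%E.
  by rewrite (ge0_integral_pushforward mN)// preimage_setT.
apply: eq_measure_integral => A mA _; apply/esym.
apply: lebesgue_cV_unique => // B mB.
change (lebesgue_cV n ((-%R : 'cV[R]_n -> 'cV[R]_n) @^-1` box B) =
  (\prod_(i < n) lebesgue_measure (B i))%E).
rewrite (_ : _ @^-1` _ = box (fun i => -%R @^-1` B i)).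
  rewrite lebesgue_box => [|i].
    by apply: eq_bigr => i _; exact: lebesgue_measureN.
  by rewrite -[X in measurable X]setTI; exact: oppr_measurable.
by apply/seteqP; split=> v Bv i; have := Bv i; rewrite /= mxE.
Qed.

End lebesgue_cV_uniqueness.

Section lebesgue_cV_blocks.
Context {R : realType}.

Definition glue N a b (g : 'I_N -> 'I_a + 'I_b) (x : 'cV[R]_a * 'cV[R]_b) :
  'cV[R]_N := \col_m match g m with inl k => x.1 k 0 | inr l => x.2 l 0 end.

Lemma measurable_glue N a b (g : 'I_N -> 'I_a + 'I_b) :
  measurable_fun setT (glue g).
Proof.
apply: measurable_fun_matrix => m j; under eq_fun do rewrite mxE.
case: (g m) => k.
  exact: (measurable_fun_entry _ _ measurable_fst).
exact: (measurable_fun_entry _ _ measurable_snd).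
Qed.

Lemma integral_lebesgue_cV_glue N a b (h : 'I_a + 'I_b -> 'I_N)
    (g : 'I_N -> 'I_a + 'I_b) (f : 'cV[R]_N -> \bar R) :
  cancel h g -> cancel g h ->
  measurable_fun setT f -> (forall v, (0 <= f v)%E) ->
  (\int[lebesgue_cV N]_v f v =
   \int[lebesgue_cV a \x lebesgue_cV b]_x f (glue g x))%E.
Proof.
move=> hK gK mf f0; have mg := @measurable_glue _ _ _ g.
transitivity (\int[pushforward (lebesgue_cV a \x lebesgue_cV b)%E (glue g)]_v
    f v)%E; last by rewrite (ge0_integral_pushforward mg)// preimage_setT.
apply: eq_measure_integral => A mA _; apply: lebesgue_cV_unique => // B mB.
change ((lebesgue_cV a \x lebesgue_cV b)%E (glue g @^-1` box B) =
  (\prod_(i < N) lebesgue_measure (B i))%E).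
rewrite (_ : _ @^-1` _ = box (fun k => B (h (inl k))) `*`
    box (fun l => B (h (inr l)))); last first.
  apply/seteqP; split=> [x Bx|x [/= B1 B2] m].
    by split=> k; [have := Bx (h (inl k))|have := Bx (h (inr k))];
      rewrite /= mxE hK.
  by rewrite /= mxE -[m in B m]gK; case: (g m).
rewrite product_measure1E; [|exact: measurable_box..].
rewrite [RHS](reindex h) /=; last by exists g => // m _.
by rewrite big_sumType /=; congr (_ * _)%E; exact: lebesgue_box.
Qed.

Local Open Scope ereal_scope.

(** Lebesgue measure does not depend on the order of the coordinates, so they
    may be split into blocks in any way that [sigma] describes. *)
Lemma integral_lebesgue_cV_blocks m N (n : 'I_m -> nat)
    (sigma : forall i, 'I_(n i) -> 'I_N)
    (f : forall i, 'cV[R]_(n i) -> \bar R) :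
  bijective (fun x : {i & 'I_(n i)} => sigma (tag x) (tagged x)) ->
  (forall i, measurable_fun setT (f i)) -> (forall i v, 0 <= f i v) ->
  \int[lebesgue_cV N]_v \prod_i f i (\col_k v (sigma i k) 0)%R =
  \prod_i \int[lebesgue_cV (n i)]_v f i v.
Proof.
(* induction on the number of blocks: the coordinates outside the first block
   are renumbered by enumerating the pairs (block, position) *)
elim: m => [|m IHm] in N n sigma f *.
  move=> [g _ gK] _ _; case: N => [|N] in sigma g gK *; last first.
    by case: (g ord0) => -[].
  rewrite [RHS]big_ord0; under eq_integral do rewrite big_ord0.
  by rewrite integral_cst//= mul1e diracT.
move=> sbij mf f0.
pose I' : finType := {i : 'I_m & 'I_(n (lift ord0 i))}.
pose h (s : 'I_(n ord0) + 'I_#|{: I'}|) : 'I_N :=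
  match s with inl k => sigma ord0 k
  | inr l => sigma (lift ord0 (tag (enum_val l))) (tagged (enum_val l)) end.
have sinj i k j l : sigma i k = sigma j l ->
    Tagged (fun i => 'I_(n i)) k = Tagged (fun i => 'I_(n i)) l.
  by move=> ijkl; apply: (bij_inj sbij).
have [g hK gK] : bijective h.
  apply: inj_surj_bij.
    case=> [k|k] [l|l] /= /sinj e.
    - by congr inl; apply: eq_from_Tagged e.
    - by have := congr1 tag e => /= /eqP; rewrite (negbTE (neq_lift _ _)).
    - by have := congr1 tag e => /= /esym/eqP; rewrite (negbTE (neq_lift _ _)).
    - congr inr; apply: enum_val_inj; move: e.
      case: (enum_val k) => i x; case: (enum_val l) => j y /= e.
      have ij : i = j by exact/(@lift_inj _ ord0)/(congr1 tag e).
      by subst j; congr existT; apply: eq_from_Tagged e.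
  move=> b; have [s' _ sK] := sbij; have := sK b.
  case: (s' b) => i x /= <-; case: (unliftP ord0 i) => [j|] ij; subst i.
    exists (inr (enum_rank (Tagged (fun i => 'I_(n (lift ord0 i))) x))).
    by rewrite /= enum_rankK.
  by exists (inl x).
pose s' (i : 'I_m) (k : 'I_(n (lift ord0 i))) : 'I_#|{: I'}| :=
  enum_rank (Tagged (fun i => 'I_(n (lift ord0 i))) k).
have mcol (N' n' : nat) (t : 'I_n' -> 'I_N') :
    measurable_fun setT (fun v : 'cV[R]_N' => \col_k v (t k) 0)%R.
  by apply: measurable_fun_matrix => i j; under eq_fun do rewrite mxE;
    exact: measurable_entry.
rewrite (integral_lebesgue_cV_glue hK gK); first last.
- by move=> v; apply: prode_ge0.
- apply: emeasurable_prod => i; exact: (measurableT_comp (mf i) (mcol _ _ _)).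
transitivity (\int[lebesgue_cV (n ord0) \x lebesgue_cV #|{: I'}|]_x
    (f ord0 x.1 *
     \prod_i f (lift ord0 i) (\col_k x.2 (@s' i k) 0)%R)).
  apply: eq_integral => x _; rewrite big_ord_recl; congr (_ * _).
    congr (f _ _); apply/colP => k; rewrite !mxE.
    by rewrite (_ : sigma _ _ = h (inl k))// hK.
  apply: eq_bigr => i _; congr (f _ _); apply/colP => k; rewrite !mxE.
  by rewrite (_ : sigma _ _ = h (inr (@s' i k))) ?hK//= enum_rankK.
rewrite (@integral_prod_mule _ _ _ _ _ _ _ (f ord0)
    (fun w : 'cV[R]_#|{: I'}| =>
      \prod_i f (lift ord0 i) (\col_k w (@s' i k) 0)%R))//.
- rewrite [RHS]big_ord_recl; congr (_ * _).
  apply: (IHm _ _ s' (fun i => f (lift ord0 i))) => //.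
  apply: inj_surj_bij => [[i k] [j l] /enum_rank_inj//|l].
  by exists (enum_val l); rewrite -[RHS]enum_valK /s'; case: (enum_val l).
- exact: mf.
- apply: emeasurable_prod => i.
  exact: (measurableT_comp (mf _) (mcol _ _ _)).
- by move=> w; apply: prode_ge0.
Qed.

End lebesgue_cV_blocks.

Section lebesgue_split.
Context {R : realType}.

Lemma cons_cV0 n (x : R * 'cV[R]_n) : cons_cV x ord0 0 = x.1.
Proof.
rewrite /cons_cV (_ : ord0 = lshift n (0 : 'I_1)); last exact: val_inj.
by rewrite [LHS]col_mxEu mxE eqxx.
Qed.

Lemma cons_cV_lift n (x : R * 'cV[R]_n) k : cons_cV x (lift ord0 k) 0 = x.2 k 0.
Proof.
rewrite /cons_cV (_ : lift ord0 k = rshift 1 k); last exact: val_inj.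
by rewrite [LHS]col_mxEd.
Qed.

Definition split_cV n (v : 'cV[R]_n.+1) : R * 'cV[R]_n :=
  (v ord0 0, \col_k v (lift ord0 k) 0).

Lemma cons_cVK n : cancel (@cons_cV R n) (@split_cV n).
Proof.
move=> x; rewrite /split_cV cons_cV0 [RHS]surjective_pairing; congr (_, _).
by apply/colP => k; rewrite mxE cons_cV_lift.
Qed.

Lemma split_cVK n : cancel (@split_cV n) (@cons_cV R n).
Proof.
move=> v; apply/colP => i; case: (unliftP ord0 i) => [k|] ->.
  by rewrite cons_cV_lift mxE.
by rewrite cons_cV0.
Qed.

Lemma measurable_split_cV n : measurable_fun setT (@split_cV n).
Proof.
apply/measurable_fun_pairP; split; first exact: measurable_entry.
apply: measurable_fun_matrix => i j.
by under eq_fun do rewrite /= mxE; exact: measurable_entry.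
Qed.

Lemma integral_lebesgue_cons n (f : R * 'cV[R]_n -> \bar R) :
  measurable_fun setT f -> (forall x, (0 <= f x)%E) ->
  (\int[lebesgue_cV n.+1]_v f (split_cV v) =
   \int[lebesgue_measure \x lebesgue_cV n]_x f x)%E.
Proof.
move=> mf f0.
have mfs := measurableT_comp mf (@measurable_split_cV n).
pose m : {measure set (measurableTypeR R * 'cV[R]_n) -> \bar R} :=
  (lebesgue_measure \x lebesgue_cV n)%E.
have mcons : measurable_fun setT
  (@cons_cV R n : measurableTypeR R * 'cV[R]_n -> _) := @measurable_cons_cV R n.
apply: etrans (ge0_integral_pushforward mcons m measurableT mfs
  (fun v _ => f0 _)) _.
by rewrite preimage_setT; apply: eq_integral => x _; rewrite /= cons_cVK.
Qed.

Lemma measurable_snd_opp n :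
  measurable_fun setT (fun x : R * 'cV[R]_n => (x.1, - x.2)).
Proof.
apply/measurable_fun_pairP; split; first exact: measurable_fst.
apply: measurable_fun_matrix => i j.
under eq_fun do rewrite /= mxE; apply: measurable_funN.
exact: (measurable_fun_entry _ _ measurable_snd).
Qed.

Lemma integral_snd_opp n (f : R * 'cV[R]_n -> \bar R) :
  measurable_fun setT f -> (forall x, (0 <= f x)%E) ->
  (\int[lebesgue_measure \x lebesgue_cV n]_x f (x.1, - x.2)%R =
   \int[lebesgue_measure \x lebesgue_cV n]_x f x)%E.
Proof.
move=> mf f0; have mopp := @measurable_snd_opp n.
rewrite fubini_tonelli1//; last exact: (measurableT_comp mf mopp).
rewrite fubini_tonelli1//; apply: eq_integral => d _.
rewrite /fubini_F /= (lebesgue_cVN (f := fun w => f (d, w)))//.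
exact: measurableT_comp.
Qed.

End lebesgue_split.

(** * Factorization of the DAG-Wishart mass *)

Section parameters.
Context {p : nat} (E : rel 'I_p) {R : realType}.
Implicit Types (i : 'I_p).

Lemma edge_in i (k : 'I_#|pa E i|) : (pa_val k, i) \in edges E.
Proof. by rewrite inE /=; exact: pa_val_in. Qed.

Definition edge_index i (k : 'I_#|pa E i|) : 'I_#|edges E| :=
  enum_rank_in (edge_in k) (pa_val k, i).

Lemma edge_indexK i (k : 'I_#|pa E i|) :
  enum_val (edge_index k) = (pa_val k, i).
Proof. by rewrite enum_rankK_in// edge_in. Qed.

Definition edge_col i (v : 'cV[R]_#|edges E|) : 'cV[R]_#|pa E i| :=
  \col_k v (edge_index k) 0.

Lemma param_lower_entry (x : 'cV[R]_p * 'cV[R]_#|edges E|) a b :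
  (param_Theta x).2 a b =
  (a == b)%:R + \sum_k x.2 k 0 * (enum_val k == (a, b))%:R.
Proof.
rewrite /= !mxE summxE; congr (_ + _); apply: eq_bigr => k _.
rewrite !mxE; case: (enum_val k) => c d.
by rewrite xpair_eqE eq_sym [b == _]eq_sym.
Qed.

Hypothesis hE : parent_ordered_dag E.

Lemma pa_col_param x i : pa_col E (param_Theta x).2 i = edge_col i x.2.
Proof.
apply/colP => k; rewrite mxE param_lower_entry mxE.
rewrite -val_eqE gtn_eqF ?(pa_val_gt hE)// add0r (bigD1 (edge_index k))//=.
rewrite edge_indexK eqxx mulr1 big1 ?addr0// => l lk.
rewrite -(edge_indexK k) (inj_eq enum_val_inj).
by rewrite (negbTE lk) mulr0.
Qed.

Lemma dag_lower_param x : dag_lower E (@param_Theta p R E x).2.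
Proof.
have L0 a b : a != b -> a \notin pa E b -> (param_Theta x).2 a b = 0.
  move=> ab aEb; rewrite param_lower_entry (negbTE ab) add0r big1// => k _.
  case: eqP => [kab|]; last by rewrite mulr0.
  by have := enum_valP k; rewrite kab inE /= (negbTE aEb).
split=> //.
- apply/is_trig_mxP => a b ab; apply: L0; first by rewrite neq_ltn ab.
  by apply/negP => /(pa_gt hE); rewrite ltnNge ltnW.
- move=> i; rewrite param_lower_entry eqxx big1 ?addr0// => k _.
  case: eqP => [kab|]; last by rewrite mulr0.
  by have := enum_valP k; rewrite kab inE /= inE eqxx.
Qed.

Lemma param_diag x i : (@param_Theta p R E x).1 i i = x.1 i 0.
Proof. by rewrite /= !mxE eqxx. Qed.

Lemma dag_Theta_param x :
  dag_Theta E (@param_Theta p R E x) <-> forall i, 0 < x.1 i 0.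
Proof.
split=> [[_ + _] i|x0]; first by move=> /(_ i); rewrite param_diag.
split; first exact: diag_mx_is_diag.
- by move=> i; rewrite param_diag.
- exact: dag_lower_param.
Qed.

Definition quad n (A : 'M[R]_n) (v : 'cV[R]_n) : R := (v^T *m A *m v) 0 0.

Lemma quadN n (A : 'M[R]_n) v : quad A (- v) = quad A v.
Proof. by rewrite /quad [(- v)^T]linearN /= !mulNmx mulmxN opprK. Qed.

(** The density is the product over [i] of these factors at
    [(D_ii, - L_{pa(i), i})]. *)
Definition block_density (U : 'M[R]_p) (alpha : 'I_p -> R) i
    (x : R * 'cV[R]_#|pa E i|) : R :=
  x.1 `^ (- (alpha i / 2)) * expR (- (1 / 2) *
    (x.1^-1 * (cond_var E U i + quad (pa_mx E U i) (x.2 - reg_coef E U i)))).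

(** Column [i] of [L] is [e_i + l] with [l] supported on the parents, so the
    left side is a quadratic polynomial in [l]: complete the square. *)
Lemma lower_congr_diag (U L : 'M[R]_p) i : posdef U -> dag_lower E L ->
  (L^T *m U *m L) i i = cond_var E U i +
    quad (pa_mx E U i) (- pa_col E L i - reg_coef E U i).
Proof.
move=> pU lL; have [UT _] := pU.
have pM := posdef_pa_mx E i pU; have [MT _] := pM.
have Mu := posdef_unitmx pM.
have tr11 (X : 'M[R]_1) : X^T = X by rewrite [X]mx11_scalar tr_scalar_mx.
rewrite -opprD quadN /cond_var.
have -> : L^T *m U *m L = (U *m L)^T *m L by rewrite trmx_mul UT.
rewrite (mul_lower_col _ _ _ lL) mxE (mul_lower_col _ _ _ lL).
set l := pa_col E L i; set r := reg_coef E U i.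
set M := pa_mx E U i in MT Mu *; set c := pa_col E U i.
have rE : M *m r = c by rewrite /r /reg_coef mulKVmx.
have row_c : pa_row E U i = c^T.
  by apply/rowP => k; rewrite !mxE -[in LHS]UT mxE.
have -> : (\row_k U i (@pa_val p E i k)) = c^T by rewrite -row_c.
have -> : (\row_k (U *m L)^T i (@pa_val p E i k)) = (c + M *m l)^T.
  apply/rowP => k; rewrite !mxE; have := mul_lower_col U i (pa_val k) lL.
  rewrite mxE => ->; congr (_ + _).
  by rewrite !mxE; apply: eq_bigr => j _; rewrite !mxE.
rewrite row_c -mulmxA -/(reg_coef E U i) -/r -rE.
move: r l {rE row_c} => r l.
rewrite /quad [(M *m r + _)^T]linearD /= [(l + r)^T]linearD /= !trmx_mul MT.
rewrite !mulmxDl !mulmxDr.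
have -> : l^T *m M *m r = r^T *m M *m l.
  by rewrite -[LHS]tr11 !trmx_mul trmxK MT mulmxA.
rewrite ![(_ + _ : 'M[R]_1) 0 0]mxE.
lra.
Qed.

Lemma invmx_diag n (r : 'rV[R]_n) : (forall i : 'I_n, r 0 i != 0) ->
  invmx (diag_mx r) = diag_mx (\row_i (r 0 i)^-1).
Proof.
move=> r0; set X := diag_mx (\row_i _).
have DX : diag_mx r *m X = 1%:M.
  rewrite mulmx_diag -diag_const_mx; congr diag_mx.
  by apply/rowP => i; rewrite !mxE divff.
by have [Du _] := mulmx1_unit DX; rewrite -[LHS]mulmx1 -DX mulKmx.
Qed.

(** The trace of [L D^-1 L^T U] is the sum over [i] of
    [D_ii^-1 (L^T U L)_ii]. *)
Lemma density_param (U : 'M[R]_p) alpha (x : 'cV[R]_p * 'cV[R]_#|edges E|) :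
  posdef U -> (forall i, 0 < x.1 i 0) ->
  dag_wishart_density U alpha (@param_Theta p R E x) =
  \prod_i block_density U alpha (x.1 i 0, - edge_col i x.2).
Proof.
move=> pU x0; rewrite /dag_wishart_density big_split /= mulrC.
congr (_ * _); first by apply: eq_bigr => i _; rewrite -param_diag.
rewrite -expR_sum -mulr_sumr; congr (expR (_ * _)).
rewrite -!mulmxA mxtrace_mulC -!mulmxA /=.
rewrite invmx_diag => [|i]; last by rewrite mxE gt_eqF.
rewrite mul_diag_mx; apply: eq_bigr => i _; rewrite mxE; congr (_ * _).
  by rewrite !mxE.
by rewrite mulmxA lower_congr_diag ?pa_col_param//; exact: dag_lower_param.
Qed.

End parameters.

Section masses.
Context {p : nat} (E : rel 'I_p) {R : realType}.
Implicit Types (i : 'I_p).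

Local Open Scope ereal_scope.

(** Every coordinate of the parameter space belongs to exactly one block: the
    diagonal entry [i] to block [i], and the edge [j -> i] to block [i]. *)
Lemma integral_edge_blocks (g : forall i, R * 'cV[R]_#|pa E i| -> \bar R) :
  (forall i, measurable_fun setT (g i)) -> (forall i x, 0 <= g i x) ->
  \int[lebesgue_cV p \x lebesgue_cV #|edges E|]_x
     \prod_i g i (x.1 i 0%R, edge_col i x.2) =
  \prod_i \int[lebesgue_measure \x lebesgue_cV #|pa E i|]_x g i x.
Proof.
move=> mg g0; set q := #|edges E|.
pose sigma i (k : 'I_#|pa E i|.+1) : 'I_(p + q) :=
  match unlift ord0 k with
  | None => lshift q i | Some l => rshift p (edge_index l) end.
have sigma0 i : sigma i ord0 = lshift q i by rewrite /sigma unlift_none.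
have sigmaS i k : sigma i (lift ord0 k) = rshift p (edge_index k).
  by rewrite /sigma liftK.
have sbij : bijective (fun x : {i & 'I_#|pa E i|.+1} =>
    sigma (tag x) (tagged x)).
  apply: inj_surj_bij => [[i k] [j l] /=|m].
    case: (unliftP ord0 k) => [k' ->|->]; case: (unliftP ord0 l) => [l' ->|->];
      rewrite ?sigma0 ?sigmaS.
    - move/rshift_inj/(congr1 enum_val); rewrite !edge_indexK => -[].
      move=> kl ij; subst j.
      by rewrite (enum_val_inj kl).
    - by move/eqP; rewrite eq_rlshift.
    - by move/eqP; rewrite eq_lrshift.
    - by move/lshift_inj => ij; subst j.
  case: (split_ordP m) => [i ->|l ->].
    by exists (Tagged (fun i => 'I_#|pa E i|.+1) (ord0 : 'I_#|pa E i|.+1)).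
  have := enum_valP l; rewrite inE; set a := (enum_val l).1.
  set b := (enum_val l).2 => ab.
  pose k : 'I_#|pa E b| := enum_rank_in ab a.
  exists (Tagged (fun i => 'I_#|pa E i|.+1) (lift ord0 k)).
  rewrite /= sigmaS; congr rshift; apply: enum_val_inj.
  by rewrite edge_indexK /pa_val enum_rankK_in// -surjective_pairing.
have msplit i := @measurable_split_cV R #|pa E i|.
have mgs i : measurable_fun setT (g i \o @split_cV R _).
  exact: (measurableT_comp (mg i) (msplit i)).
have := @integral_lebesgue_cV_blocks R _ _ _ sigma
  (fun i => g i \o @split_cV R _) sbij mgs (fun i v => g0 i _).
under [in X in _ = X -> _]eq_bigr do rewrite integral_lebesgue_cons//.
move=> <-.
rewrite (@integral_lebesgue_cV_glue _ _ _ _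
  (@fintype.unsplit p q) (@fintype.split p q)).
- apply: eq_integral => x _; apply: eq_bigr => i _ /=; congr (g i (_, _)).
    by rewrite !mxE sigma0 (unsplitK (inl _)).
  by apply/colP => k; rewrite !mxE sigmaS (unsplitK (inr _)).
- exact: unsplitK.
- exact: splitK.
- apply: emeasurable_prod => i; apply: (measurableT_comp (mgs i)).
  by apply: measurable_fun_matrix => k l; under eq_fun do rewrite mxE;
    exact: measurable_entry.
- by move=> v; apply: prode_ge0 => i; exact: g0.
Qed.

End masses.

Section wishart_mass.
Context {p : nat} (E : rel 'I_p) {R : realType}.
Hypothesis hE : parent_ordered_dag E.
Variables (U : 'M[R]_p) (alpha : 'I_p -> R).
Hypothesis pU : posdef U.
Implicit Types (i : 'I_p).

Lemma measurable_quad d (T : measurableType d) n (A : T -> 'M[R]_n)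
    (v : T -> 'cV[R]_n) : measurable_fun setT A -> measurable_fun setT v ->
  measurable_fun setT (fun t => quad (A t) (v t)).
Proof.
move=> mA mv; apply: measurable_fun_entry.
by do 2?[apply: measurable_mulmx => //]; exact: measurable_trmx.
Qed.

Lemma measurable_subcst n (m : 'cV[R]_n) :
  measurable_fun setT (fun v : 'cV[R]_n => v - m).
Proof.
apply: measurable_fun_matrix => i j; under eq_fun do rewrite !mxE.
by apply: measurable_funB => //; exact: measurable_entry.
Qed.

Lemma measurable_block_density i :
  measurable_fun setT (@block_density p E R U alpha i).
Proof.
have m1 : measurable_fun setT (fst : R * 'cV[R]_#|pa E i| -> R).
  exact: measurable_fst.
apply: measurable_funM; first exact: (measurableT_comp (measurable_powR _)).
apply: (measurableT_comp (@measurable_expR R)); apply: measurable_funM => //.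
apply: measurable_funM; first exact: (measurableT_comp measurable_inv).
apply: measurable_funD => //; apply: measurable_quad => //.
exact: (measurableT_comp (measurable_subcst _) measurable_snd).
Qed.

Lemma block_density_ge0 i x : 0 <= @block_density p E R U alpha i x.
Proof. by rewrite mulr_ge0 ?powR_ge0 ?expR_ge0. Qed.

Lemma measurable_dag_Theta : measurable (@dag_Theta p R E).
Proof.
have mentry1 a b (B : set R) : measurable B ->
    measurable [set DL : 'M[R]_p * 'M[R]_p | B (DL.1 a b)].
  move=> mB; rewrite -[X in measurable X]setTI.
  exact: (measurable_fun_entry a b measurable_fst).
have mentry2 a b (B : set R) : measurable B ->
    measurable [set DL : 'M[R]_p * 'M[R]_p | B (DL.2 a b)].
  move=> mB; rewrite -[X in measurable X]setTI.
  exact: (measurable_fun_entry a b measurable_snd).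
have mif (b : bool) (S : set ('M[R]_p * 'M[R]_p)) : measurable S ->
    measurable [set x | b -> S x].
  case: b => mS; last by rewrite (_ : [set _ | _] = setT)//; apply/seteqP.
  rewrite (_ : [set _ | _] = S)//; apply/seteqP; split=> x //=; exact.
rewrite (_ : dag_Theta E =
    [set DL : 'M[R]_p * 'M[R]_p |
      forall a b : 'I_p, (a != b -> [set 0] (DL.1 a b))] `&`
    [set DL : 'M[R]_p * 'M[R]_p |
      forall a : 'I_p, [set` `]0, +oo[] (DL.1 a a)] `&`
    [set DL : 'M[R]_p * 'M[R]_p |
      forall a b : 'I_p, (a < b)%N -> [set 0] (DL.2 a b)] `&`
    [set DL : 'M[R]_p * 'M[R]_p | forall a : 'I_p, [set 1] (DL.2 a a)] `&`
    [set DL : 'M[R]_p * 'M[R]_p | forall a b : 'I_p,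
      (a != b) && (a \notin pa E b) -> [set 0] (DL.2 a b)]).
  by do !apply: measurableI; repeat (apply: measurable_forall_fin => ?);
    try apply: mif; try apply: mentry1; try apply: mentry2.
apply/seteqP; split=> [DL [/is_diag_mxP dD D0 [/is_trig_mxP lL L1 L0]]|DL].
  split; [split; [split; [split|]|]|] => a //=.
  - by move=> b ab; exact: dD.
  - by rewrite in_itv/= D0.
  - by move=> b; exact: lL.
  - by move=> b /andP[]; exact: L0.
move=> [[[[dD D0] lL] L1] L0]; split; [| |split] => //.
- by apply/is_diag_mxP => a b ab; exact: dD.
- by move=> a; have := D0 a; rewrite /= in_itv/= andbT.
- by apply/is_trig_mxP => a b ab; exact: lL.
- by move=> a b ab aE; apply: L0; rewrite ab.
Qed.

Lemma measurable_dag_wishart_density :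
  measurable_fun setT (dag_wishart_density U alpha).
Proof.
have m1 : measurable_fun setT (fst : 'M[R]_p * 'M[R]_p -> 'M[R]_p).
  exact: measurable_fst.
have m2 : measurable_fun setT (snd : 'M[R]_p * 'M[R]_p -> 'M[R]_p).
  exact: measurable_snd.
apply: measurable_funM.
  apply: (measurableT_comp (@measurable_expR R)); apply: measurable_funM => //.
  apply: measurable_sum => i; apply: measurable_fun_entry.
  do 3?[apply: measurable_mulmx => //]; first exact: measurable_invmx.
  exact: measurable_trmx.
apply: measurable_prod => i _.
by apply: (measurableT_comp (measurable_powR _)); exact: measurable_fun_entry.
Qed.

Lemma dag_wishart_density_ge0 DL : 0 <= dag_wishart_density U alpha DL.
Proof.
by rewrite mulr_ge0 ?expR_ge0// prodr_ge0// => i _; exact: powR_ge0.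
Qed.

Local Open Scope ereal_scope.

Definition block_mass i (B : set (R * 'cV[R]_#|pa E i|)) : \bar R :=
  \int[lebesgue_measure \x lebesgue_cV #|pa E i|]_(x in
    B `&` [set x | (0 < x.1)%R]) (block_density U alpha x)%:E.

Lemma measurable_fst_gt0 n :
  measurable [set x : R * 'cV[R]_n | (0 < x.1)%R].
Proof.
rewrite (_ : [set _ | _] = [set` `]0%R, +oo[] `*` setT); last first.
  by apply/seteqP; split=> x /=; rewrite in_itv/= andbT // => -[].
by apply: measurableX => //; exact: measurable_itv.
Qed.

(** Tonelli's theorem for the factored density.  The sign in the second
    component is harmless, since Lebesgue measure is symmetric. *)
Lemma dag_wishart_mass_blocks (A : set ('M[R]_p * 'M[R]_p))
    (B : forall i, set (R * 'cV[R]_#|pa E i|)) :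
  measurable A -> (forall i, measurable (B i)) ->
  (forall x : 'cV[R]_p * 'cV[R]_#|edges E|, (forall i, 0 < x.1 i 0)%R ->
    A (param_Theta x) <-> forall i, B i (x.1 i 0, - edge_col i x.2)%R) ->
  dag_wishart_mass E U alpha A = \prod_i block_mass (B i).
Proof.
move=> mA mB AB; have mparam : measurable_fun setT (@param_Theta p R E).
  exact: measurable_param_Theta.
pose f i := (fun x => (@block_density p E R U alpha i x)%:E) \_
  (B i `&` [set x | (0 < x.1)%R]).
have mBpos i : measurable (B i `&` [set x | (0 < x.1)%R]).
  by apply: measurableI => //; exact: measurable_fst_gt0.
have mf i : measurable_fun setT (f i).
  apply/(measurable_restrictT _ (mBpos i)); apply: measurable_funTS.
  by apply/measurable_EFinP; exact: measurable_block_density.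
have f0 i x : 0 <= f i x.
  by apply: erestrict_ge0 => // y _; rewrite lee_fin block_density_ge0.
transitivity (\int[lebesgue_cV p \x lebesgue_cV #|edges E|]_x
    \prod_i f i (x.1 i 0, - edge_col i x.2)%R); last first.
  rewrite (integral_edge_blocks (g := fun i x => f i (x.1, - x.2)%R)).
  - by apply: eq_bigr => i _; rewrite integral_snd_opp// [RHS]integral_mkcond.
  - by move=> i; exact: (measurableT_comp (mf i) (@measurable_snd_opp R _)).
  - by move=> i x; exact: f0.
have mATheta : measurable (A `&` dag_Theta E).
  by apply: measurableI => //; exact: measurable_dag_Theta.
rewrite /dag_wishart_mass /lebesgue_Theta (ge0_integral_pushforward mparam)//.
- rewrite integral_mkcond; apply: eq_integral => x _.
  rewrite patchE; case: ifPn => [|/negP xA].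
    rewrite inE => -[Ax /(dag_Theta_param hE) x0] /=.
    rewrite (density_param _ _ pU)// -prodEFin; apply: eq_bigr => i _.
    rewrite /f patchE mem_set//; split; last exact: x0.
    by have /(AB _ x0) := Ax.
  apply/esym; have [i Hi] : exists i, f i (x.1 i 0, - edge_col i x.2)%R = 0.
    apply: contrapT => /forallNP fn0; apply: xA; rewrite inE.
    have fn i : (B i `&` [set x | (0 < x.1)%R]) (x.1 i 0, - edge_col i x.2)%R.
      apply: contrapT => nB; apply: (fn0 i); rewrite /f patchE memNset//.
    have x0 i : (0 < x.1 i 0)%R by have [] := fn i.
    split; last exact/dag_Theta_param.
    by apply/(AB _ x0) => i; have [] := fn i.
  by rewrite (bigD1 i)//= Hi mul0e.
- apply: measurable_funTS; apply/measurable_EFinP.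
  exact: measurable_dag_wishart_density.
- by move=> DL _; rewrite lee_fin dag_wishart_density_ge0.
Qed.

End wishart_mass.

(** * Gaussian integrals *)

Section schur_complement.
Context {R : realType} (n : nat).
Variable A : 'M[R]_(1 + n).
Hypothesis pA : posdef A.

Definition schur : 'M[R]_n :=
  drsubmx A - (A 0 0)^-1 *: (dlsubmx A *m (dlsubmx A)^T).

Let a := A 0 0.
Let b : 'cV[R]_n := dlsubmx A.

Let AE : A = block_mx a%:M b^T b (drsubmx A).
Proof.
rewrite -[LHS]submxK; congr block_mx.
  by rewrite [LHS]mx11_scalar !mxE; congr (A _ _)%:M; exact: val_inj.
have [AT _] := pA; apply/matrixP => i j; rewrite !mxE -[in LHS]AT mxE.
by [].
Qed.

Lemma posdef_corner_gt0 : 0 < A 0 0.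
Proof.
have [_ /(_ (delta_mx 0 0))] := pA.
rewrite trmx_delta -rowE -colE !mxE; apply.
by apply/eqP => /matrixP/(_ 0 0); rewrite !mxE !eqxx => /eqP; rewrite oner_eq0.
Qed.

Let a0 : a != 0. Proof. by rewrite gt_eqF// posdef_corner_gt0. Qed.

(** Completing the square in the first coordinate. *)
Lemma quad_schur (x : R) (w : 'cV[R]_n) :
  quad A (col_mx x%:M w) =
  A 0 0 * (x + (A 0 0)^-1 * ((dlsubmx A)^T *m w) 0 0) ^+ 2 + quad schur w.
Proof.
have tr11 (X : 'M[R]_1) : X^T = X by rewrite [X]mx11_scalar tr_scalar_mx.
rewrite /quad /schur -/a -/b [in LHS]AE tr_col_mx mul_row_block mul_row_col.
rewrite tr_scalar_mx !mulmxDl mulmxBr mulmxBl -scalemxAr -scalemxAl.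
have -> : w^T *m (b *m b^T) *m w = ((b^T *m w) 0 0 ^+ 2)%:M.
  have -> : w^T *m (b *m b^T) *m w = (b^T *m w)^T *m (b^T *m w).
    by rewrite trmx_mul trmxK !mulmxA.
  by rewrite tr11 [X in X *m _]mx11_scalar [X in _ *m X]mx11_scalar -scalar_mxM.
have -> : w^T *m b *m x%:M = x%:M *m (b^T *m w).
  by rewrite -[LHS]tr11 !trmx_mul trmxK tr_scalar_mx.
rewrite -(mulmxA x%:M b^T) [b^T *m w]mx11_scalar -!scalar_mxM.
rewrite !mxE eqxx !mulr1n.
by field.
Qed.

Lemma posdef_schur : posdef schur.
Proof.
have [AT A_gt0] := pA; split.
  rewrite /schur linearB linearZ /= trmx_mul trmxK; congr (_ - _).
  by rewrite -[in LHS]AT; apply/matrixP => i j; rewrite !mxE.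
move=> w w0; have := @A_gt0 (col_mx (- (a^-1 * (b^T *m w) 0 0))%:M w).
rewrite -/(quad _ _) quad_schur addNr expr0n mulr0 add0r; apply.
apply: contra_neq w0 => /(congr1 dsubmx); rewrite col_mxKd => ->.
by apply/colP => i; rewrite !mxE.
Qed.

Lemma det_schur : \det A = A 0 0 * \det schur.
Proof.
have AE2 : A = block_mx 1%:M 0 (a^-1 *: b) 1%:M *m block_mx a%:M b^T 0 schur.
  rewrite mulmx_block !mul1mx !mul0mx !addr0 [LHS]AE; congr block_mx.
    by rewrite -scalemxAl mul_mx_scalar scalerA mulVf// scale1r.
  by rewrite -scalemxAl addrC subrK.
rewrite [LHS](congr1 determinant AE2).
by rewrite det_mulmx det_lblock det_ublock !det1 !mul1r det_scalar1.
Qed.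

End schur_complement.

Lemma posdef_det_gt0 {R : realType} n (A : 'M[R]_n) : posdef A -> 0 < \det A.
Proof.
elim: n => [|n IHn] in A *; first by rewrite det_mx00.
move=> pA; rewrite (@det_schur R n A pA) mulr_gt0//.
  exact: (@posdef_corner_gt0 R n A).
exact/IHn/posdef_schur.
Qed.

Section gauss.
Context {R : realType}.
Local Open Scope ereal_scope.

Lemma integral_gauss_1d (a m : R) : (0 < a)%R ->
  \int[lebesgue_measure]_x (expR (- (1 / 2) * (a * (x + m) ^+ 2)))%:E =
  (Num.sqrt (2 * pi / a))%:E.
Proof.
move=> a0; pose s : R := (Num.sqrt a)^-1%R.
have s0 : s != 0%R by rewrite invr_neq0// gt_eqF// sqrtr_gt0.
have s2 : (s ^+ 2 = a^-1)%R by rewrite exprVn sqr_sqrtr// ltW.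
have peak0 := normal_peak_gt0 s0.
have := integral_normal_pdf (- m) s.
rewrite normal_pdfE//; under eq_integral do rewrite EFinM.
rewrite ge0_integralZl_EFin ?(ltW peak0)//; first last.
- by apply/measurable_EFinP; exact: measurable_normal_fun.
- by move=> x _; rewrite lee_fin normal_fun_ge0.
move=> /(congr1 (fun z => (normal_peak s)^-1%:E * z)).
rewrite mule1 muleA -EFinM mulVf ?mul1e ?gt_eqF// /normal_peak invrK s2 => H.
transitivity ((Num.sqrt (a^-1 * pi *+ 2))%:E); last first.
  by congr (Num.sqrt _)%:E; rewrite -mulr_natl; ring.
rewrite -H; apply: eq_integral => x _; congr (expR _)%:E.
rewrite s2 opprK; field; exact: lt0r_neq0.
Qed.

(** Integrating out the first coordinate is a one-dimensional Gaussian integral,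
    whose mean depends on the other coordinates and whose value does not; the
    Schur complement governs what remains.  Thus no linear change of variables
    is needed. *)
Lemma integral_gauss n (A : 'M[R]_n) (m : 'cV[R]_n) : posdef A ->
  \int[lebesgue_cV n]_v (expR (- (1 / 2) * quad A (v - m)))%:E =
  (Num.sqrt ((2 * pi) ^+ n / \det A))%:E.
Proof.
elim: n => [|n IHn] in A m *.
  move=> _; rewrite det_mx00 expr0 divr1 sqrtr1.
  under eq_integral => v _.
    rewrite (_ : quad _ _ = 0)%R ?mulr0 ?expR0; last first.
      by rewrite /quad mxE big_ord0.
    over.
  by rewrite integral_cst//= mul1e diracT.
move=> pA; have a0 := posdef_corner_gt0 pA; have pS := posdef_schur pA.
pose a : R := A 0%R 0%R; pose b := (dlsubmx (A : 'M[R]_(1 + n)))^T%R.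
pose S := @schur R n A; pose m' : 'cV[R]_n := dsubmx (m : 'cV[R]_(1 + n)).
pose f (x : R * 'cV[R]_n) : \bar R :=
  (expR (- (1 / 2) * quad A (cons_cV x - m)%R))%:E.
have mN : measurable_fun setT (fun v : 'cV[R]_n.+1 =>
    (expR (- (1 / 2) * quad A (v - m)%R))%:E).
  apply/measurable_EFinP; apply: (measurableT_comp (@measurable_expR R)).
  apply: measurable_funM => //; apply: measurable_quad => //.
  exact: measurable_subcst.
have mf : measurable_fun setT f.
  exact: (measurableT_comp mN (@measurable_cons_cV R n)).
have f0 x : 0 <= f x by rewrite lee_fin expR_ge0.
transitivity (\int[lebesgue_measure \x lebesgue_cV n]_x f x).
  apply: etrans (integral_lebesgue_cons mf f0); apply: eq_integral => v _.
  by rewrite /f split_cVK.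
rewrite fubini_tonelli2//.
have fE x w : f (x, w) =
    (expR (- (1 / 2) *
      (a * (x + (a^-1 * (b *m (w - m')) 0%R 0%R - m 0%R 0%R)) ^+ 2)))%:E *
    (expR (- (1 / 2) * quad S (w - m')%R))%:E.
  rewrite /f -EFinM -expRD -mulrDr.
  have -> : (cons_cV (x, w) - m = col_mx (x - m 0 0)%:M (w - m'))%R.
    apply/colP => i; case: (unliftP ord0 i) => [k|] ->.
      rewrite mxE cons_cV_lift.
      rewrite [in RHS](_ : lift ord0 k = rshift 1 k); last exact: val_inj.
      rewrite [RHS]col_mxEd !mxE; congr (_ - m _ _)%R; exact: val_inj.
    rewrite mxE cons_cV0.
    rewrite [in RHS](_ : ord0 = lshift n (0%R : 'I_1)); last exact: val_inj.
    by rewrite [RHS]col_mxEu !mxE eqxx.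
  have -> := @quad_schur R n A pA (x - m 0 0)%R (w - m')%R.
  by rewrite /a /b /S [(_ - m _ _)%R in RHS]addrC [in RHS]addrA.
have mg1 k : measurable_fun setT (fun x : R =>
    expR (- (1 / 2) * (a * (x + k) ^+ 2)))%R.
  apply: (measurableT_comp (@measurable_expR R)); apply: measurable_funM => //.
  apply: measurable_funM => //; apply: measurable_funX.
  exact: measurable_funD.
transitivity (\int[lebesgue_cV n]_w ((Num.sqrt (2 * pi / a))%:E *
    (expR (- (1 / 2) * quad S (w - m')%R))%:E)).
  apply: eq_integral => w _; rewrite /fubini_G.
  under eq_integral do rewrite fE.
  rewrite ge0_integralZr//; last by apply/measurable_EFinP; exact: mg1.
  by rewrite integral_gauss_1d.
rewrite ge0_integralZl_EFin ?sqrtr_ge0//.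
- rewrite IHn// -EFinM -sqrtrM; last first.
    by rewrite divr_ge0 ?mulr_ge0 ?pi_ge0// ltW.
  congr (Num.sqrt _)%:E; rewrite (det_schur pA) -/a -/S exprS invfM.
  by rewrite mulrACA.
- apply/measurable_EFinP; apply: (measurableT_comp (@measurable_expR R)).
  apply: measurable_funM => //; apply: measurable_quad => //.
  exact: measurable_subcst.
Qed.

End gauss.

Section normal_kernel.
Context {R : realType} (n : nat).
Implicit Types (S M : 'M[R]_n) (m : 'cV[R]_n).

Lemma posdef_invmx S : posdef S -> posdef (invmx S).
Proof.
move=> pS; have Su := posdef_unitmx pS; have [ST _] := pS.
have -> : invmx S = (invmx S)^T *m S *m invmx S.
  by rewrite mulmxK// trmx_inv ST.
apply: posdef_congr => // x Sx; rewrite -[x]mul1mx -(mulmxV Su) -mulmxA Sx.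
by rewrite mulmx0.
Qed.

Lemma posdef_scale (s : R) S : 0 < s -> posdef S -> posdef (s *: S).
Proof.
move=> s0 [ST S_gt0]; split; first by rewrite linearZ /= ST.
move=> x x0; rewrite -scalemxAr -scalemxAl mxE mulr_gt0//; exact: S_gt0.
Qed.

Lemma mvnormal_pdf_ge0 m S x : 0 <= mvnormal_pdf m S x.
Proof. by rewrite divr_ge0 ?expR_ge0 ?sqrtr_ge0. Qed.

Lemma measurable_mvnormal_pdf S m :
  measurable_fun setT (fun z : R * 'cV[R]_n => mvnormal_pdf m (z.1 *: S) z.2).
Proof.
have mS : measurable_fun setT (fun z : R * 'cV[R]_n => z.1 *: S).
  apply: measurable_fun_matrix => i j; under eq_fun do rewrite mxE.
  by apply: measurable_funM => //; exact: measurable_fst.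
apply: measurable_funM.
  apply: (measurableT_comp (@measurable_expR R)); apply: measurable_funM => //.
  exact: (measurable_quad (measurable_invmx mS)
    (measurableT_comp (measurable_subcst m) measurable_snd)).
apply: (measurableT_comp measurable_inv).
have msqrt : measurable_fun setT (@Num.sqrt R).
  by apply: continuous_measurable_fun; exact: sqrt_continuous.
apply: (measurableT_comp msqrt).
by apply: measurable_funM => //; exact: measurable_det.
Qed.

Lemma mvnormal_setT m S : posdef S -> mvnormal m S setT = 1%E.
Proof.
move=> pS; have dS := posdef_det_gt0 pS; rewrite /mvnormal.
have c0 : 0 < (2 * pi : R) ^+ n by rewrite exprn_gt0// mulr_gt0 ?pi_gt0.
under eq_integral do rewrite EFinM.
rewrite ge0_integralZr//.
- rewrite (integral_gauss m (posdef_invmx pS)) det_inv invrK -EFinM divff//.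
  by rewrite gt_eqF// sqrtr_gt0 mulr_gt0.
- apply/measurable_EFinP; apply: (measurableT_comp (@measurable_expR R)).
  apply: measurable_funM => //.
  exact: (measurable_quad (measurable_cst (invmx S)) (measurable_subcst m)).
Qed.

Lemma measurable_mvnormal m S (B : set 'cV[R]_n) : measurable B ->
  measurable_fun setT (fun s : R => mvnormal m (s *: S) B).
Proof.
move=> mB; pose f (z : R * 'cV[R]_n) : \bar R :=
  ((fun z : R * 'cV[R]_n => (mvnormal_pdf m (z.1 *: S) z.2)%:E)
    \_ (setT `*` B)) z.
have mTB : measurable ([set: R] `*` B) by exact: measurableX.
have mf : measurable_fun setT f.
  apply/(measurable_restrictT _ mTB); apply: measurable_funTS.
  by apply/measurable_EFinP; exact: measurable_mvnormal_pdf.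
have f0 z : (0 <= f z)%E.
  by apply: erestrict_ge0 => // y _; rewrite lee_fin mvnormal_pdf_ge0.
rewrite (_ : (fun _ => _) = fubini_F (lebesgue_cV n) f).
  exact: measurable_fun_fubini_tonelli_F.
apply/funext => s; rewrite /mvnormal integral_mkcond /fubini_F.
apply: eq_integral => x _; rewrite /f !patchE.
have [xB|xB] := pselect (B x).
  by rewrite !mem_set.
by rewrite !memNset// => -[].
Qed.

(** The power of [s] is the one that integrating out a Gaussian vector of
    covariance [s M^-1] moves into the density of [s]. *)
Lemma mvnormal_scaleE m M (s : R) x : posdef M -> 0 < s ->
  expR (- (1 / 2) * (s^-1 * quad M (x - m))) =
  Num.sqrt ((2 * pi) ^+ n / \det M) * s `^ (n%:R / 2) *
  mvnormal_pdf m (s *: invmx M) x.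
Proof.
move=> pM s0; have Mu := posdef_unitmx pM; have dM := posdef_det_gt0 pM.
have c0 : 0 < (2 * pi : R) ^+ n by rewrite exprn_gt0// mulr_gt0 ?pi_gt0.
rewrite /mvnormal_pdf invmxZ ?invmxK; last first.
  by apply: posdef_unitmx; apply: posdef_scale => //; exact: posdef_invmx.
have -> : Num.sqrt ((2 * pi) ^+ n * \det (s *: invmx M)) =
    Num.sqrt ((2 * pi) ^+ n / \det M) * s `^ (n%:R / 2).
  rewrite detZ det_inv mulrCA mulrC sqrtrM; last by rewrite divr_ge0// ltW.
  congr (_ * _).
  by rewrite -powR12_sqrt ?exprn_ge0 ?ltW// -powR_mulrn ?ltW// -powRrM.
have -> : ((x - m)^T *m (s^-1 *: M) *m (x - m)) 0 0 = s^-1 * quad M (x - m).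
  by rewrite -scalemxAr -scalemxAl mxE.
by rewrite [RHS]mulrC divfK// gt_eqF// mulr_gt0 ?powR_gt0// sqrtr_gt0 divr_gt0.
Qed.

End normal_kernel.

(** * The inverse gamma integral *)

Lemma cvg_integral_exhaust_gt0 {R : realType} (c : R) (f : R -> \bar R) :
  0 < c -> measurable_fun setT f -> (forall x, (0 <= f x)%E) ->
  ((\int[lebesgue_measure]_(x in `[(c / n.+1%:R)%R, (c * n.+1%:R)%R]) f x)%E
     @[n --> \oo] --> (\int[lebesgue_measure]_(x in `]0%R, +oo[) f x)%E).
Proof.
move=> c0 mf f0.
have -> : [set` `]0, +oo[] =
    \bigcup_n [set` `[(c / n.+1%:R)%R, (c * n.+1%:R)%R]] :> set R.
  apply/seteqP; split=> [x /=|x [n _] /=]; rewrite !in_itv/=; last first.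
    by rewrite andbT => /andP[+ _]; apply: lt_le_trans; rewrite divr_gt0.
  rewrite andbT => x0.
  exists (maxn (Num.bound (c / x)) (Num.bound (x / c))) => //=.
  have bound_le (y : R) n : 0 <= y -> (Num.bound y <= n)%N -> y <= n.+1%:R.
    move=> y0 yn; apply: ltW; apply: lt_trans (archi_boundP y0) _.
    by rewrite ltr_nat ltnS.
  rewrite in_itv /=; apply/andP; split.
    rewrite ler_pdivrMr// mulrC -ler_pdivrMr// bound_le ?leq_maxl//.
    by rewrite divr_ge0// ltW.
  by rewrite mulrC -ler_pdivrMr// bound_le ?leq_maxr// divr_ge0// ltW.
apply: ge0_nondecreasing_set_cvg_integral => //.
- move=> m n mn; apply/subsetPset => x /=; rewrite !in_itv/= => /andP[cx xc].
  apply/andP; split.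
    apply: le_trans cx; rewrite ler_pM2l// lef_pV2 ?posrE// ler_nat ltnS//.
  by apply: le_trans xc _; rewrite ler_pM2l// ler_nat ltnS.
- by move=> n; exact: measurable_funTS.
Qed.

Section inverse_gamma_integral.
Context {R : realType}.
Variables (a b : R).
Hypothesis b0 : 0 < b.

Let F (x : R) : R := b * x^-1.
Let G (y : R) : R := y `^ (a - 1) * expR (- y).

Let is_derive_F (x : R) : x != 0 -> is_derive x (1 : R) F (- b * x ^- 2).
Proof.
move=> x0; rewrite /F.
have V : is_derive x 1 (fun y : R => y^-1) (- x ^- 2 *: (1 : R)).
  exact: (is_deriveV (f := id)).
have := is_deriveM (is_derive_cst b x 1) V.
rewrite (_ : _ + _ = - b * x ^- 2)//.
by rewrite scaler0 addr0 /GRing.scale /= mulr1 mulrN mulNr.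
Qed.

Let F'E x : x != 0 -> F^`()%classic x = - b * x ^- 2.
Proof. by move=> /is_derive_F D; rewrite derive1E derive_val. Qed.

Let continuous_F' x : x != 0 -> {for x, continuous F^`()%classic}.
Proof.
move=> x0; rewrite /prop_for /continuous_at F'E//.
have : - b * y ^- 2 @[y --> x] --> - b * x ^- 2.
  apply: cvgM; first exact: cvg_cst.
  apply: cvgV; first by rewrite expf_neq0.
  exact: exprn_continuous.
apply: cvg_trans; apply: near_eq_cvg; near=> y.
rewrite F'E//; near: y.
exact: open_neq.
Unshelve. all: by end_near. Qed.

Let continuous_F x : x != 0 -> {for x, continuous F}.
Proof.
move=> x0; apply: differentiable_continuous; apply/derivable1_diffP.
by have [] := is_derive_F x0.
Qed.

Let continuous_G y : 0 < y -> {for y, continuous G}.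
Proof.
move=> y0; have cpow : {for y, continuous (fun z : R => z `^ (a - 1))}.
  apply: differentiable_continuous; apply/derivable1_diffP.
  by apply: derivable_powR; rewrite in_itv/= y0.
apply: cvgM; first exact: cpow.
by apply: continuous_comp; [exact: opp_continuous|exact: continuous_expR].
Qed.

Let substituted x : 0 < x -> ((G \o F) * - F^`()%classic) x =
  b `^ a * (x `^ (- a - 1) * expR (- b / x)).
Proof.
move=> x0; transitivity (G (F x) * - F^`()%classic x); first by [].
rewrite F'E ?lt0r_neq0// /F /G powRM ?invr_ge0 ?ltW//.
have -> : b `^ a = b `^ (a - 1) * b.
  by rewrite -[X in _ * X](powRr1 (ltW b0)) -powRD ?subrK// lt0r_neq0 ?implybT.
have -> : x `^ (- a - 1) = x^-1 `^ (a - 1) * x ^- 2.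
  rewrite -(powR_inv1 (ltW x0)) -powRrM -(powR_invn 2 (ltW x0)) -powRD.
    by congr (_ `^ _); ring.
  by rewrite lt0r_neq0 ?implybT.
rewrite mulNr opprK mulNr; ring.
Qed.

Lemma integral_inv_substitution (s t : R) : 0 < s -> s <= t ->
  (\int[lebesgue_measure]_(y in `[(b / t)%R, (b / s)%R]) (G y)%:E =
   \int[lebesgue_measure]_(x in `[s, t])
     (b `^ a * (x `^ (- a - 1) * expR (- b / x)))%:E)%E.
Proof.
move=> s0 st; have t0 : 0 < t := lt_le_trans s0 st.
have stgt0 (x : R) : x \in `[s, t] -> 0 < x.
  by rewrite in_itv/= => /andP[+ _]; exact: lt_le_trans.
have stogt0 (x : R) : x \in `]s, t[ -> 0 < x.
  by rewrite in_itv/= => /andP[+ _]; exact: lt_trans.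
rewrite (@integration_by_substitution_decreasing _ F)//; first last.
- apply: continuous_in_subspaceT => y; rewrite inE /= in_itv /= => /andP[ty _].
  by apply: continuous_G; apply: lt_le_trans ty; rewrite mulr_gt0// invr_gt0.
- split.
  + by move=> x /stogt0 x0; have [] := is_derive_F (lt0r_neq0 x0).
  + by apply: cvg_at_right_filter; exact/continuous_F/lt0r_neq0.
  + by apply: cvg_at_left_filter; exact/continuous_F/lt0r_neq0.
- apply/cvg_ex; exists (F^`()%classic t); apply: cvg_at_left_filter.
  exact/continuous_F'/lt0r_neq0.
- apply/cvg_ex; exists (F^`()%classic s); apply: cvg_at_right_filter.
  exact/continuous_F'/lt0r_neq0.
- by move=> x /stogt0 x0; exact/continuous_F'/lt0r_neq0.
- move=> x y /stgt0 x0 /stgt0 y0 xy; rewrite /F ltr_pM2l//.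
  by rewrite ltf_pV2.
apply: eq_integral => x; rewrite inE => /stgt0 x0; congr EFin.
exact: substituted.
Qed.

Local Open Scope ereal_scope.

(** Substitution of [b / x] on the intervals [[1 / n, n]], then the limit; both
    sides may be infinite. *)
Lemma integral_inverse_gamma :
  (\int[lebesgue_measure]_(x in `]0%R, +oo[)
     (x `^ (- a - 1) * expR (- b / x))%:E =
  (b `^ (- a))%:E * \int[lebesgue_measure]_(x in `]0%R, +oo[)
     (x `^ (a - 1) * expR (- x))%:E).
Proof.
have mpow (r : R) : measurable_fun setT (@powR R ^~ r) := measurable_powR r.
have mGF : measurable_fun setT (fun x => (x `^ (- a - 1) * expR (- b / x))%:E).
  apply/measurable_EFinP; apply: measurable_funM => //.
  apply: (measurableT_comp (@measurable_expR R)); apply: measurable_funM => //.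
  exact: measurable_inv.
have mG : measurable_fun setT (EFin \o G).
  apply/measurable_EFinP; apply: measurable_funM => //.
  by apply: (measurableT_comp (@measurable_expR R)).
have G0 x : 0 <= (G x)%:E by rewrite lee_fin mulr_ge0 ?powR_ge0 ?expR_ge0.
have GF0 x : 0 <= (x `^ (- a - 1) * expR (- b / x))%:E.
  by rewrite lee_fin mulr_ge0 ?powR_ge0 ?expR_ge0.
have lim1 := cvg_integral_exhaust_gt0 b0 mG G0.
have lim2 : \int[lebesgue_measure]_(x in `[(1 / n.+1%:R)%R, (1 * n.+1%:R)%R])
     (b `^ a * (x `^ (- a - 1) * expR (- b / x)))%:E @[n --> \oo] -->
   \int[lebesgue_measure]_(x in `]0%R, +oo[)
     (b `^ a * (x `^ (- a - 1) * expR (- b / x)))%:E.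
  apply: cvg_integral_exhaust_gt0 => //.
    by under eq_fun do rewrite EFinM; exact: measurable_funeM.
  by move=> x; rewrite EFinM mule_ge0// lee_fin powR_ge0.
have -> : \int[lebesgue_measure]_(x in `]0%R, +oo[)
       (x `^ (a - 1) * expR (- x))%:E =
     \int[lebesgue_measure]_(x in `]0%R, +oo[)
       (b `^ a * (x `^ (- a - 1) * expR (- b / x)))%:E.
  rewrite -(cvg_lim (@ereal_hausdorff R) lim1).
  rewrite -(cvg_lim (@ereal_hausdorff R) lim2).
  congr (lim (_ @ \oo)); apply/funext => n.
  have n0 : (0 < n.+1%:R :> R)%R by rewrite ltr0n.
  rewrite -integral_inv_substitution ?mul1r ?invr_gt0//; first by rewrite invrK.
  by rewrite (@le_trans _ _ 1%R)// ?ler1n// invf_le1// ler1n.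
under [in RHS]eq_integral do rewrite EFinM.
rewrite ge0_integralZl_EFin ?powR_ge0//; last exact: measurable_funTS.
by rewrite muleA -EFinM powRN mulVf ?mul1e// gt_eqF// powR_gt0.
Qed.

End inverse_gamma_integral.

(** * The law of one block *)

Lemma posdef_diag_gt0 {R : realType} n (A : 'M[R]_n) i : posdef A -> 0 < A i i.
Proof.
move=> [_ /(_ (delta_mx i 0))]; rewrite trmx_delta -rowE -colE !mxE; apply.
by apply/eqP => /matrixP/(_ i 0); rewrite !mxE !eqxx => /eqP; rewrite oner_eq0.
Qed.

Section block_masses.
Context {p : nat} (E : rel 'I_p) {R : realType}.
Hypothesis hE : parent_ordered_dag E.
Variables (U : 'M[R]_p) (alpha : 'I_p -> R).
Hypothesis pU : posdef U.
Variable i : 'I_p.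

Let n := #|pa E i|.
Let M := pa_mx E U i.
Let r := reg_coef E U i.

(** It is the value of [U] at the column of a unitriangular [L] chosen so as to
    annihilate the square in [lower_congr_diag]. *)
Lemma cond_var_gt0 : 0 < cond_var E U i.
Proof.
(* the parent entries of column [i] are minus the regression coefficients *)
pose L : 'M[R]_p := \matrix_(a, b) ((a == b)%:R -
  (b == i)%:R * \sum_(k < n) r k 0 * (a == pa_val k)%:R).
have sum0 a : a \notin pa E i -> \sum_(k < n) r k 0 * (a == pa_val k)%:R = 0.
  move=> aE; apply: big1 => k _; case: eqP => [ak|]; last by rewrite mulr0.
  by move: aE; rewrite ak pa_val_in.
have L0 a b : a != b -> a \notin pa E b -> L a b = 0.
  move=> ab aE; rewrite mxE (negbTE ab) sub0r; case: eqP => [bi|]; last first.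
    by rewrite mul0r oppr0.
  by subst b; rewrite sum0// mulr0 oppr0.
have lL : dag_lower E L.
  split=> //.
  - apply/is_trig_mxP => a b ab; apply: L0; first by rewrite neq_ltn ab.
    by apply/negP => /(pa_gt hE); rewrite ltnNge ltnW.
  - move=> a; rewrite mxE eqxx; case: eqP => [ai|]; last by rewrite mul0r subr0.
    by subst a; rewrite sum0 ?mulr0 ?subr0// inE eqxx.
have := lower_congr_diag i pU lL.
rewrite (_ : - pa_col E L i - _ = 0); last first.
  apply/colP => k; rewrite !mxE eqxx mul1r.
  rewrite -val_eqE gtn_eqF ?(pa_val_gt hE)// sub0r.
  rewrite opprK (bigD1 k)//= eqxx mulr1 big1 ?addr0; first by rewrite mxE subrr.
  move=> l lk; rewrite (inj_eq (@pa_val_inj _ _ _)) eq_sym (negbTE lk) mulr0//.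
rewrite /quad mulmx0 [X in _ + X]mxE addr0 => <-.
apply: posdef_diag_gt0; apply: posdef_congr => // x Lx.
by rewrite -[x](mulKmx (dag_lower_unitmx lL)) Lx mulmx0.
Qed.

Let a : R := alpha i / 2 - n%:R / 2 - 1.
Let b : R := 1 / 2 * cond_var E U i.
Let g (d : R) : R := d `^ (- a - 1) * expR (- b / d).
Let K : R := Num.sqrt ((2 * pi) ^+ n / \det M).

Let b0 : 0 < b. Proof. by rewrite mulr_gt0 ?divr_gt0// cond_var_gt0. Qed.

Let pM : posdef M. Proof. exact: posdef_pa_mx. Qed.

Let K0 : 0 < K.
Proof.
by rewrite sqrtr_gt0 divr_gt0 ?posdef_det_gt0// exprn_gt0// mulr_gt0 ?pi_gt0.
Qed.

Let g0 d : 0 <= g d. Proof. by rewrite mulr_ge0 ?powR_ge0 ?expR_ge0. Qed.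

Let measurable_g : measurable_fun setT g.
Proof.
apply: measurable_funM; first exact: measurable_powR.
apply: (measurableT_comp (@measurable_expR R)); apply: measurable_funM => //.
exact: measurable_inv.
Qed.

Let block_densityE d v : 0 < d ->
  @block_density p E R U alpha i (d, v) =
  K * g d * mvnormal_pdf r (d *: invmx M) v.
Proof.
move=> d0; rewrite /block_density /= mulrDr mulrDr expRD.
rewrite (mvnormal_scaleE _ _ pM d0) -/n -/K -/r /g.
have -> : - (1 / 2) * (d^-1 * cond_var E U i) = - b / d by rewrite /b; ring.
have -> : d `^ (- a - 1) = d `^ (- (alpha i / 2)) * d `^ (n%:R / 2).
  rewrite -powRD; first by congr (_ `^ _); rewrite /a; ring.
  by rewrite lt0r_neq0 ?implybT.
ring.
Qed.

Local Open Scope ereal_scope.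

Lemma mvnormal_ge0 m (S : 'M[R]_m) (x : 'cV[R]_m) C : 0 <= mvnormal x S C.
Proof. by apply: integral_ge0 => v _; rewrite lee_fin mvnormal_pdf_ge0. Qed.

(** Tonelli, with the conditional Gaussian law of the second component made
    explicit. *)
Lemma block_mass_prod (A : set R) (C : set 'cV[R]_n) :
  measurable A -> measurable C ->
  block_mass U alpha (A `*` C : set (R * 'cV[R]_#|pa E i|)) =
  K%:E * \int[lebesgue_measure]_(d in A `&` [set` `]0%R, +oo[])
    ((g d)%:E * mvnormal r (d *: invmx M) C).
Proof.
move=> mA mC; rewrite /block_mass integral_mkcond.
set D := _ `&` _.
have mD : measurable D.
  by apply: measurableI; [exact: measurableX|exact: measurable_fst_gt0].
have mf : measurable_fun setT
    ((fun x => (@block_density p E R U alpha i x)%:E) \_ D).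
  apply/(measurable_restrictT _ mD); apply: measurable_funTS.
  by apply/measurable_EFinP; exact: measurable_block_density.
rewrite fubini_tonelli1//; last first.
  move=> x; apply: erestrict_ge0 => // y _.
  by rewrite lee_fin block_density_ge0.
have mApos : measurable (A `&` [set` `]0%R, +oo[]).
  by apply: measurableI => //; exact: measurable_itv.
rewrite -ge0_integralZl_EFin//; first last.
- exact: ltW.
- apply: measurable_funTS; apply: emeasurable_funM.
    exact/measurable_EFinP.
  exact: measurable_mvnormal.
- by move=> d _; rewrite mule_ge0 ?lee_fin// mvnormal_ge0.
rewrite [RHS]integral_mkcond; apply: eq_integral => d _.
rewrite /fubini_F [RHS]patchE; case: ifPn => [|/negP dA].
  rewrite inE /= in_itv/= andbT => -[Ad d0].
  rewrite muleA -EFinM /mvnormal -ge0_integralZl_EFin//; first last.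
  - by rewrite mulr_ge0// ltW.
  - apply: measurable_funTS; apply/measurable_EFinP.
    exact: (measurableT_comp (measurable_mvnormal_pdf (invmx M) r)
      (pair1_measurable d)).
  - by move=> v _; rewrite lee_fin mvnormal_pdf_ge0.
  rewrite [RHS]integral_mkcond; apply: eq_integral => v _; rewrite !patchE.
  have [Cv|Cv] := pselect (C v).
    by rewrite !mem_set// block_densityE// EFinM.
  by rewrite !memNset// => -[[]].
rewrite integral0_eq// => v _; rewrite patchE memNset// => -[[/= Ad _] /= d0].
by apply: dA; rewrite inE /= in_itv/= d0.
Qed.

Let integrand1 (A : set R) : A `<=` [set` `]0%R, +oo[] ->
  \int[lebesgue_measure]_(d in A) ((g d)%:E * mvnormal r (d *: invmx M) setT) =
  \int[lebesgue_measure]_(d in A) (g d)%:E.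
Proof.
move=> A0; apply: eq_integral => d; rewrite inE => /A0 /=.
rewrite in_itv/= andbT => d0.
rewrite mvnormal_setT ?mule1//.
by apply: posdef_scale => //; exact: posdef_invmx.
Qed.

Hypothesis mass_fin :
  block_mass U alpha (setT : set (R * 'cV[R]_#|pa E i|)) \is a fin_num.
Hypothesis mass_neq0 :
  block_mass U alpha (setT : set (R * 'cV[R]_#|pa E i|)) != 0.

(** A finite nonzero mass forces the Gamma integral to be finite and nonzero. *)
Let block_massT : (0 < Gamma a)%R /\
  block_mass U alpha (setT : set (R * 'cV[R]_#|pa E i|)) =
  (K * (b `^ (- a) * Gamma a))%:E.
Proof.
have := block_mass_prod (@measurableT _ R) (@measurableT _ 'cV[R]_n).
rewrite setXTT setTI integrand1//.
rewrite (integral_inverse_gamma a b0).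
rewrite /Gamma /Rintegral.
set G := \int[_]_(_ in _) _ => massE.
have G_ge0 : 0 <= G.
  by apply: integral_ge0 => x _; rewrite lee_fin mulr_ge0 ?powR_ge0 ?expR_ge0.
have Gfin : G \is a fin_num.
  rewrite ge0_fin_numE// ltey; apply/eqP => Goo; move: mass_fin.
  by rewrite massE Goo !gt0_muley ?lte_fin ?powR_gt0.
move: massE; rewrite -(fineK Gfin) -!EFinM => massE; split=> //.
rewrite lt0r /= fine_ge0// andbT.
by apply: contraNneq mass_neq0 => /= G00; rewrite massE /= G00 !mulr0.
Qed.

Definition block_law (B : set (R * 'cV[R]_#|pa E i|)) : \bar R :=
  block_mass U alpha B *
  (fine (block_mass U alpha (setT : set (R * 'cV[R]_#|pa E i|))))^-1%:E.

Lemma block_law_prod (A : set R) (C : set 'cV[R]_n) :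
  measurable A -> measurable C ->
  block_law (A `*` C) =
  \int[lebesgue_measure]_(d in A `&` [set` `]0%R, +oo[])
    ((inverse_gamma_pdf a b d)%:E * mvnormal r (d *: invmx M) C).
Proof.
move=> mA mC; have [Gamma0 massT] := block_massT.
rewrite /block_law massT /= block_mass_prod//.
have mApos : measurable (A `&` [set` `]0%R, +oo[]).
  by apply: measurableI => //; exact: measurable_itv.
have ba0 := powR_gt0 a b0.
transitivity ((b `^ a / Gamma a)%:E *
    \int[lebesgue_measure]_(d in A `&` [set` `]0%R, +oo[])
      ((g d)%:E * mvnormal r (d *: invmx M) C)).
  rewrite muleAC -EFinM; congr (_%:E * _).
  rewrite powRN; field.
  by rewrite !gt_eqF// K0.
rewrite -ge0_integralZl_EFin//; first last.
- by rewrite divr_ge0// ltW.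
- apply: measurable_funTS; apply: emeasurable_funM.
    exact/measurable_EFinP.
  exact: measurable_mvnormal.
- by move=> d _; rewrite mule_ge0 ?lee_fin// mvnormal_ge0.
apply: eq_integral => d _; rewrite muleA -EFinM; congr (_%:E * _).
by rewrite /inverse_gamma_pdf /g mulrA.
Qed.

Lemma block_law_inverse_gamma (A : set R) : measurable A ->
  block_law (A `*` setT) = inverse_gamma a b A.
Proof.
move=> mA; rewrite block_law_prod//; apply: eq_integral => d; rewrite inE.
move=> -[_] /=; rewrite in_itv/= andbT => d0.
rewrite mvnormal_setT ?mule1//.
by apply: posdef_scale => //; exact: posdef_invmx.
Qed.

End block_masses.

(** * Densities and product laws *)

Section density.
Local Open Scope ereal_scope.
Context d (T : measurableType d) (R : realType).

(** [g] is almost everywhere the Radon-Nikodym derivative of [nu]. *)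
Lemma integral_density (nu : {finite_measure set T -> \bar R})
    (mu : {sigma_finite_measure set T -> \bar R}) (g : T -> R) (f : T -> \bar R)
    (D : set T) :
  measurable_fun setT g -> (forall x, 0 <= g x)%R ->
  (forall A, measurable A -> nu A = \int[mu]_(x in A) (g x)%:E) ->
  measurable D -> measurable_fun setT f -> (forall x, 0 <= f x) ->
  \int[nu]_(x in D) f x = \int[mu]_(x in D) (f x * (g x)%:E).
Proof.
move=> mg g0 nuE mD mf f0.
have mEg : measurable_fun setT (EFin \o g) by exact/measurable_EFinP.
have numu : nu `<< mu.
  apply/null_content_dominatesP => A mA muA0; rewrite nuE//.
  by apply: null_set_integral => //; exact: measurable_funTS.
have iRN := Radon_Nikodym_SigmaFinite.f_integrable numu.
have mRN := measurable_int _ iRN.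
rewrite -(Radon_Nikodym_SigmaFinite.change_of_variables numu f0 mD); last first.
  exact: measurable_funTS.
apply: ae_eq_integral => //.
- by apply: measurable_funTS; exact: emeasurable_funM.
- by apply: measurable_funTS; exact: emeasurable_funM.
have RNg : ae_eq mu setT (Radon_Nikodym_SigmaFinite.f nu mu) (EFin \o g).
  apply: integral_ae_eq => // A _ mA.
  by rewrite -Radon_Nikodym_SigmaFinite.f_integral// nuE.
by apply: ae_eqe_mul2l; apply: ae_eq_subset RNg.
Qed.

End density.

Section product_law.
Local Open Scope ereal_scope.
Context {R : realType}.

Lemma prode_fin_neq0 (I : finType) (m : I -> \bar R) :
  (forall i, 0 <= m i) -> \prod_i m i \is a fin_num -> \prod_i m i != 0 ->
  forall i, m i \is a fin_num /\ m i != 0.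
Proof.
move=> m0 + + i; rewrite (bigD1 i)//= => pfin p0.
have mi0 : m i != 0 by apply: contraNneq p0 => ->; rewrite mul0e.
split=> //; rewrite ge0_fin_numE// ltey; apply/eqP => mioo.
have q0 : 0 < \prod_(j | j != i) m j.
  rewrite lt0e prode_ge0// andbT.
  by apply: contraNneq p0 => ->; rewrite mule0.
by move: pfin; rewrite mioo gt0_mulye.
Qed.

Context d (T : measurableType d) (P : probability T R) (I : finType) d'
  (S : I -> measurableType d') (X : forall i, T -> S i).
Variable m : forall i, set (S i) -> \bar R.
Hypothesis m_ge0 : forall i B, 0 <= m (i := i) B.
Hypothesis mX : forall i, measurable_fun setT (X i).
Hypothesis PE : forall B : forall i, set (S i), (forall i, measurable (B i)) ->
  P [set t | forall i, B i (X i t)] =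
  \prod_i m (B i) * (fine (\prod_i m (setT : set (S i))))^-1%:E.

Let q i (B : set (S i)) : \bar R := m B * (fine (m (setT : set (S i))))^-1%:E.

(** A normalising constant that turns the product into a probability can only
    be the product of finite, nonzero factors. *)
Lemma product_law_mass i :
  m (setT : set (S i)) \is a fin_num /\ m (setT : set (S i)) != 0.
Proof.
apply: (prode_fin_neq0 (m := fun i => m (setT : set (S i)))) => //.
  have := PE (fun i => measurableT).
  rewrite (_ : [set _ | _] = setT); last first.
    by apply/seteqP.
  rewrite probability_setT; case: (\prod_i _) => [//| |] /=.
  - by rewrite invr0 mule0 => /eqP; rewrite onee_eq0.
  - by rewrite invr0 mule0 => /eqP; rewrite onee_eq0.
have := PE (fun i => measurableT); rewrite (_ : [set _ | _] = setT); last first.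
  by apply/seteqP.
by apply: contra_eq_neq => ->; rewrite mul0e probability_setT onee_neq0.
Qed.

Lemma product_law (B : forall i, set (S i)) : (forall i, measurable (B i)) ->
  P [set t | forall i, B i (X i t)] = \prod_i q (B i).
Proof.
move=> mB; rewrite PE// big_split /=; congr (_ * _).
rewrite prodEFin prodfV; congr (_^-1%:E).
rewrite [in LHS](eq_bigr (fun i => (fine (m (setT : set (S i))))%:E)).
  by rewrite prodEFin.
by move=> i _; rewrite fineK//; have [] := product_law_mass i.
Qed.

Let qT i : q (setT : set (S i)) = 1.
Proof.
have [mfin m0] := product_law_mass i.
by rewrite /q -{1}(fineK mfin) -EFinM divff// fine_eq0.
Qed.

Lemma product_law_marginal i (B : set (S i)) : measurable B ->
  P (X i @^-1` B) = q B.
Proof.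
move=> mB; pose B' := @dfwith _ (fun i => set (S i)) (fun=> setT) i B.
have B'i : B' i = B by rewrite /B' dfwithin.
have B'j j : i != j -> B' j = setT by move=> ij; rewrite /B' dfwithout.
have := @product_law B' _; rewrite (bigD1 i)//= B'i big1 ?mule1; last first.
  by move=> j ji; rewrite B'j ?qT// eq_sym.
move=> <-; last first.
  by move=> j; have [<-|ij] := eqVneq i j; rewrite ?B'i// B'j.
congr (P _); apply/seteqP; split=> [t Bt j|t /(_ i)]; last by rewrite B'i.
by have [<-|ij] := eqVneq i j; rewrite ?B'i// B'j.
Qed.

Lemma product_law_independent : mutually_independent P X.
Proof.
split=> // J B mB.
pose B' i := if i \in J then B i else setT.
transitivity (P [set t | forall i, B' i (X i t)]).
  congr (P _); apply/seteqP; split=> [t Bt i|t Bt i /= iJ]; rewrite /B'.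
    by case: ifP => // iJ; exact: Bt.
  by have := Bt i; rewrite /B' iJ.
rewrite product_law => [|i]; last by rewrite /B'; case: ifP.
rewrite [RHS]big_mkcond; apply: eq_bigr => i _; rewrite /B'.
by case: ifP => _; [rewrite product_law_marginal|exact: qT].
Qed.

End product_law.

(** * The blocks of the completed matrix *)

Section completed_sample.
Context (R : realType) (p : nat) (E : rel 'I_p)
    (U : 'M[R]_p) (alpha : 'I_p -> R)
    (d : measure_display) (T : measurableType d) (P : probability T R)
    (SigmaE Sigma : T -> 'M[R]_p).
Hypothesis hE : parent_ordered_dag E.
Hypothesis pU : posdef U.
Hypothesis hSigmaE : has_law P SigmaE (dag_wishart_S E U alpha).
Hypothesis hSigma : forall t, dag_completion E (SigmaE t) (Sigma t).

Definition block (i : 'I_p) (S : 'M[R]_p) : R * 'cV[R]_#|pa E i| :=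
  (cond_var E S i, reg_coef E S i).

Lemma measurable_block i : measurable_fun setT (block i).
Proof.
apply/measurable_fun_pairP; split.
  exact: measurable_cond_var.
exact: measurable_reg_coef.
Qed.

Let mcblock i : measurable_fun setT (block i \o completion E).
Proof.
exact: measurableT_comp (@measurable_block i) (@measurable_completion p E R).
Qed.

Let blockE i t : block i (Sigma t) = (block i \o completion E) (SigmaE t).
Proof. by have [PDt <-] := hSigma t; rewrite /= (completionE hE PDt). Qed.

Lemma measurable_sample_block i :
  measurable_fun setT (fun t => block i (Sigma t)).
Proof.
rewrite (_ : (fun _ => _) = (block i \o completion E) \o SigmaE); last first.
  by apply/funext => t; exact: blockE.
have [mSigmaE _] := hSigmaE.
exact: measurableT_comp (@mcblock i) mSigmaE.
Qed.

(** The block of [Sigma] at [i] is a measurable function of [SigmaE]; on the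
    parameter space this function is [D_ii, - L_{pa(i), i}]. *)
Lemma sample_blocks (B : forall i, set (R * 'cV[R]_#|pa E i|)) :
  (forall i, measurable (B i)) ->
  P [set t | forall i, B i (block i (Sigma t))] =
  (\prod_i block_mass U alpha (B i) *
   (fine (\prod_i block_mass U alpha
     (setT : set (R * 'cV[R]_#|pa E i|))))^-1%:E)%E.
Proof.
move=> mB; pose A := [set S | forall i, B i (block i (completion E S))].
have mA : measurable A.
  apply: (measurable_forall_fin (S := fun i =>
    (block i \o completion E) @^-1` B i)) => i.
  rewrite -[X in measurable X]setTI.
  exact: (@mcblock i measurableT (B i) (mB i)).
have [_ law] := hSigmaE.
have -> : [set t | forall i, B i (block i (Sigma t))] = SigmaE @^-1` A.
  by apply/seteqP; split=> t Bt i; have := Bt i; rewrite blockE.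
rewrite law// /dag_wishart_S /pushforward /dag_wishart_Theta.
rewrite (@dag_wishart_mass_blocks _ _ _ hE U alpha pU _ B)//.
- rewrite (@dag_wishart_mass_blocks _ _ _ hE U alpha pU _ (fun=> setT))//.
- rewrite -[X in measurable X]setTI.
  by apply: (measurableT_comp (measurable_dag_proj E)
    (@measurable_dag_cov p R)).
- move=> x x0; set DL := param_Theta x.
  have DLTheta : dag_Theta E DL by exact/dag_Theta_param.
  have DLE : DL = (DL.1, DL.2) by exact: surjective_pairing.
  have cE i : block i (completion E (dag_proj E (dag_cov DL))) =
      (x.1 i 0, - edge_col i x.2).
    rewrite completionE//; last by exists DL.
    rewrite /block DLE cond_var_dag_cov -?DLE// reg_coef_dag_cov -?DLE//.
    by rewrite param_diag pa_col_param.
  by split=> Bx i; have := Bx i; rewrite /= cE.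
Qed.

End completed_sample.

Lemma inverse_gamma_pdf_ge0 (R : realType) (a b x : R) :
  0 <= inverse_gamma_pdf a b x.
Proof.
rewrite /inverse_gamma_pdf !mulr_ge0 ?powR_ge0 ?expR_ge0//.
rewrite invr_ge0; apply: Rintegral_ge0 => y _.
by rewrite mulr_ge0 ?powR_ge0 ?expR_ge0.
Qed.

Lemma measurable_inverse_gamma_pdf (R : realType) (a b : R) :
  measurable_fun setT (inverse_gamma_pdf a b).
Proof.
apply: measurable_funM.
  by apply: measurable_funM => //; exact: measurable_powR.
apply: (measurableT_comp (@measurable_expR R)); apply: measurable_funM => //.
exact: measurable_inv.
Qed.

Theorem theorem5p9 (R : realType) (p : nat) (E : rel 'I_p)
    (U : 'M[R]_p) (alpha : 'I_p -> R)
    (d : measure_display) (T : measurableType d) (P : probability T R)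
    (SigmaE Sigma : T -> 'M[R]_p)
    (hE : parent_ordered_dag E)
    (hU : posdef U)
    (halpha : forall i, alpha i > #|pa E i|%:R + 2)
    (hSigmaE : has_law P SigmaE (dag_wishart_S E U alpha))
    (hSigma : forall t, dag_completion E (SigmaE t) (Sigma t)) :
  mutually_independent P
    (fun (i : 'I_p) t => (cond_var E (Sigma t) i, reg_coef E (Sigma t) i)) /\
  (forall i : 'I_p,
    has_law P (fun t => cond_var E (Sigma t) i)
      (inverse_gamma (alpha i / 2 - #|pa E i|%:R / 2 - 1)
                     (1 / 2 * cond_var E U i)) /\
    has_cond_law P (fun t => reg_coef E (Sigma t) i)
      (fun t => cond_var E (Sigma t) i)
      (fun s => mvnormal (reg_coef E U i) (s *: invmx (pa_mx E U i)))).
Proof.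
have mX i := measurable_sample_block hE hSigmaE hSigma (i := i).
have mass_ge0 i (B : set (R * 'cV[R]_#|pa E i|)) :
    (0 <= block_mass U alpha B)%E.
  by apply: integral_ge0 => x _; rewrite lee_fin block_density_ge0.
have blocks := sample_blocks hE hU hSigmaE hSigma.
split; first exact: (product_law_independent mass_ge0 mX blocks).
move=> i; have [mass_fin mass0] := product_law_mass mass_ge0 blocks i.
have law (B : set (R * 'cV[R]_#|pa E i|)) : measurable B ->
    P ((fun t => block E i (Sigma t)) @^-1` B) = block_law U alpha B.
  exact: (product_law_marginal mass_ge0 blocks).
have mY : measurable_fun setT (fun t => cond_var E (Sigma t) i).
  exact: (measurableT_comp measurable_fst (mX i)).
have mZ : measurable_fun setT (fun t => reg_coef E (Sigma t) i).
  exact: (measurableT_comp measurable_snd (mX i)).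
set a := _ - _ - 1; set b := 1 / 2 * _.
have lawY A : measurable A ->
    P ((fun t => cond_var E (Sigma t) i) @^-1` A) = inverse_gamma a b A.
  move=> mA; rewrite -(block_law_inverse_gamma hE hU mass_fin mass0 mA).
  rewrite -law; last exact: measurableX.
  by congr (P _); apply/seteqP; split=> t //= [].
split; first by [].
split=> // [B mB|A B mA mB]; first exact: measurable_mvnormal.
have mpos : measurable [set` `]0%R, +oo[ : interval R] by exact: measurable_itv.
(* the inverse gamma density extended by 0, so that the law of the conditional
   variance has a density on the whole line *)
pose g := inverse_gamma_pdf a b \_ [set` `]0%R, +oo[].
have gE x : (g x)%:E =
    ((EFin \o inverse_gamma_pdf a b) \_ [set` `]0%R, +oo[]) x.
  by rewrite /g !patchE; case: ifP.
have g_ge0 x : 0 <= g x.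
  by rewrite /g patchE; case: ifP => // _; exact: inverse_gamma_pdf_ge0.
have mg : measurable_fun setT g.
  apply/(measurable_restrictT _ mpos); apply: measurable_funTS.
  exact: measurable_inverse_gamma_pdf.
pose Y : {mfun T >-> measurableTypeR R} :=
  HB.pack (fun t => cond_var E (Sigma t) i : measurableTypeR R)
    (isMeasurableFun.Build _ _ T (measurableTypeR R) _ mY).
pose k s := mvnormal (reg_coef E U i) (s *: invmx (pa_mx E U i)) B.
have mk : measurable_fun setT k by exact: measurable_mvnormal.
have k0 s : (0 <= k s)%E by exact: mvnormal_ge0.
transitivity (\int[distribution P Y]_(s in A) k s)%E; last first.
  by rewrite ge0_integral_pushforward//; exact: measurable_funTS.
pose nu : {finite_measure set (measurableTypeR R) -> \bar R} :=
  distribution P Y.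
have nuE C : measurable C ->
    nu C = (\int[lebesgue_measure]_(x in C) (g x)%:E)%E.
  move=> mC; apply: etrans (lawY C mC) _.
  rewrite /inverse_gamma integral_mkcondr.
  by apply: eq_integral => x _; rewrite gE.
apply: etrans (esym (integral_density (mu := lebesgue_measure)
  mg g_ge0 nuE mA mk k0)).
transitivity (block_law U alpha (A `*` B : set (R * 'cV[R]_#|pa E i|))).
  rewrite -law; last exact: measurableX.
  by congr (P _); apply/seteqP; split=> t //= [].
rewrite (block_law_prod hE hU mass_fin mass0)// integral_mkcondr.
apply: eq_integral => x _; rewrite gE !patchE; case: ifP => // _.
  by rewrite muleC.
by rewrite mule0.
Qed.
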